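(* Consider site percolation on the triangular lattice and let $0\le p<0.5$. Then there exist positive constants $C_1=C_1(p)$ and $C_2=C_2(p)$ such that for all integers $n\ge1$, $$\mathbf{P}_p\left(\mathbf{C}(\mathbf{0})\cap\partial[-n,n]^2\ne\emptyset\right)\le C_1\exp(-C_2 n)$$ and $$\mathbf{P}_{1-p}\left(\mathbf{C}^*(\mathbf{0})\cap\partial[-n,n]^2\ne\emptyset\right)\le C_1\exp(-C_2 n).$$
   Context: Triangular lattice: the vertex set is $\mathbf{Z}^2$, and the nearest neighbors of $(x,y)$ are $(x\pm1,y)$, $(x,y\pm1)$, $(x+1,y-1)$, $(x-1,y+1)$. For $r\in[0,1]$, under $\mathbf{P}_r$ each vertex is open with probability $r$ and closed with probability $1-r$, independently of all others. A path is a finite sequence of distinct vertices in which consecutive vertices are nearest neighbors; it is open (resp. closed) if all its vertices are open (resp. closed). $\mathbf{C}(\mathbf{0})$ is the open cluster of the origin $\mathbf{0}=(0,0)$: the set of vertices connected to $\mathbf{0}$ by an open path (empty if $\mathbf{0}$ is closed). $\mathbf{C}^*(\mathbf{0})$ is the closed cluster of the origin: the set of vertices connected to $\mathbf{0}$ by a closed path (empty if $\mathbf{0}$ is open). $\partial[-n,n]^2$ is the set of boundary vertices of $[-n,n]^2$, i.e. the vertices $(x,y)\in\mathbf{Z}^2$ with $\max(|x|,|y|)=n$. *)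

(* Defs.v *)
From mathcomp Require Import all_boot all_order all_algebra.
From mathcomp Require Import all_classical all_reals all_analysis.
Import Order.TTheory GRing.Theory Num.Theory.

Set Implicit Arguments.
Unset Strict Implicit.
Unset Printing Implicit Defensive.

Local Open Scope classical_set_scope.
Local Open Scope ring_scope.

Definition vertex : Type := (int * int)%type.

Definition origin : vertex := (0, 0).

(* Nearest neighbours in the triangular lattice, embedded in Z^2. *)
Definition neighbors (v : vertex) : seq vertex :=
  [:: (v.1 + 1, v.2); (v.1 - 1, v.2); (v.1, v.2 + 1); (v.1, v.2 - 1);
      (v.1 + 1, v.2 - 1); (v.1 - 1, v.2 + 1)].

Definition lattice_adj : rel vertex := fun u v => v \in neighbors u.

(* The nonempty sequence x :: s of distinct vertices is a lattice path;
   s = [::] gives the one-vertex path. *)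
Definition lattice_path (x : vertex) (s : seq vertex) : bool :=
  path lattice_adj x s && uniq (x :: s).

(* The vertices joined to x by a path with all its vertices, endpoints
   included, in S; this is empty when x is not in S. *)
Definition site_cluster (S : pred vertex) (x : vertex) : set vertex :=
  [set y | exists s : seq vertex,
     [/\ lattice_path x s, all S (x :: s) & last x s = y]].

(* In a configuration, true means open and false means closed. *)
Definition configuration : Type := vertex -> bool.

Definition open_cluster (omega : configuration) (x : vertex) : set vertex :=
  site_cluster omega x.

Definition closed_cluster (omega : configuration) (x : vertex) : set vertex :=
  site_cluster (fun v => ~~ omega v) x.

Definition box_boundary (n : nat) : set vertex :=
  [set v | Num.max `|v.1| `|v.2| = n%:Z].

Definition mutually_independent (d d' : measure_display) (T : measurableType d)
    (T' : measurableType d') (R : realType) (P : probability T R)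
    (I : choiceType) (X : I -> {RV P >-> T'}) : Prop :=
  forall (s : seq I) (B : I -> set T'),
    uniq s -> (forall i, measurable (B i)) ->
    P (\bigcap_(i in [set` s]) (X i @^-1` B i)) =
    (\prod_(i <- s) P (X i @^-1` B i))%E.

(* The law P_r is presented by an arbitrary probability space carrying
   independent vertex states X v, each open with probability r.  The joint law
   of the states, hence the probability of any event they determine, does not
   depend on the space. *)
Definition site_percolation (d : measure_display) (T : measurableType d)
    (R : realType) (P : probability T R) (r : R)
    (X : vertex -> {RV P >-> bool}) : Prop :=
  (forall v, P [set w | X v w = true] = r%:E) /\ mutually_independent X.

(* Main.v *)
(** Let [theta_n(t)] be the probability that the origin is joined to the sphere of
radius [n], and for a finite [S] containing the origin let [psi_t(S)] be the mean
number of sites of the outer boundary of [S] adjacent to the cluster of the origin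
in [S].  If [psi_p(S) < 1] for some [S] in the box of radius [L - 1], then exploring
that cluster gives [theta_(n+L)(p) <= psi_p(S) theta_n(p)], hence exponential decay
(Duminil-Copin and Tassion).

Otherwise [psi_t(S) >= 1] for all [S] and all [t >= p], and Russo's formula yields
[theta_n' >= 1 - theta_n], so that [theta_n(q)] is bounded below for some
[p < q < 1/2].  Independence of far apart boxes upgrades this to
[P_q(box_N <-> sphere_n) -> 1] as [N] grows, uniformly in [n].  Under any product
measure with densities in [[q, 1 - q]], Harris' inequality and the symmetries of the
square then join a box of radius [N] to the left and right sides of a large square
by open paths, and to its top and bottom sides by closed ones, with probability at
least 1/2.  In this situation, opening all the sites of the box reduces the number
of clusters touching the boundary of a square of radius [M].  Raising the density
from [q] to [1/2] in one block after the other lowers the mean of this number by a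
constant for each of about [M ^ 2] blocks; this is absurd since it is [O(M)]. *)

Require Import Defs.
From mathcomp Require Import all_boot all_order all_algebra.
From mathcomp Require Import all_classical all_reals all_analysis.
From mathcomp Require Import zify ring lra.
Import Order.TTheory GRing.Theory Num.Theory.

Set Implicit Arguments.
Unset Strict Implicit.
Unset Printing Implicit Defensive.

Local Open Scope classical_set_scope.
Local Open Scope ring_scope.

(** * Finite product measures: independence, Harris' inequality, exploration, Russo's formula *)

Section FiniteProduct.
Context {R : realType} {I : eqType}.
Implicit Types (r : I -> R) (D : seq I) (w : I -> bool).
Implicit Types (F G : (I -> bool) -> R) (A B : set I).

Definition upd w (i : I) (b : bool) : I -> bool :=
  fun j => if j == i then b else w j.

Definition config_le w w' : Prop := forall i, w i -> w' i.

Definition depends_on {T : Type} A (F : (I -> bool) -> T) : Prop :=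
  forall w w', (forall i, A i -> w i = w' i) -> F w = F w'.

Definition increasing_rv F : Prop :=
  forall w w', config_le w w' -> F w <= F w'.

Definition decreasing_rv F : Prop :=
  forall w w', config_le w w' -> F w' <= F w.

Definition increasing_event (E : set (I -> bool)) : Prop :=
  forall w w', config_le w w' -> E w -> E w'.

Definition is_prob r : Prop := forall i, 0 <= r i <= 1.

(* [expect r D F w] averages [F] over independent states of the sites in [D],
   site [i] being open with probability [r i], the other sites being frozen in
   the state prescribed by [w]. *)
Fixpoint expect r D F w : R :=
  if D is i :: D' then
    r i * expect r D' F (upd w i true) + (1 - r i) * expect r D' F (upd w i false)
  else F w.

Definition prob r D (E : set (I -> bool)) w : R := expect r D (\1_E) w.

Lemma updC w i j b c : i != j -> upd (upd w i b) j c = upd (upd w j c) i b.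
Proof.
move=> ij; apply/funext => k; rewrite /upd.
by case: (eqVneq k j) => [->|//]; rewrite eq_sym (negbTE ij).
Qed.

Lemma upd_upd w i b c : upd (upd w i b) i c = upd w i c.
Proof. by apply/funext => k; rewrite /upd; case: eqP. Qed.

Lemma config_le_upd w w' i (b c : bool) : config_le w w' -> (b -> c) ->
  config_le (upd w i b) (upd w' i c).
Proof. by move=> ww' bc j; rewrite /upd; case: eqP => // _; exact: ww'. Qed.

Lemma config_le_upd_true w i : config_le w (upd w i true).
Proof. by move=> j; rewrite /upd; case: eqP. Qed.

Lemma config_le_upd_false w i : config_le (upd w i false) w.
Proof. by move=> j; rewrite /upd; case: eqP. Qed.

Lemma depends_on_upd {T : Type} A (F : (I -> bool) -> T) w i b :
  depends_on A F -> ~ A i -> F (upd w i b) = F w.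
Proof.
move=> FA Ai; apply: FA => j Aj; rewrite /upd; case: eqP => // ji.
by rewrite ji in Aj.
Qed.

Lemma depends_on_prop A (E : set (I -> bool)) :
  (forall w w', (forall i, A i -> w i = w' i) -> E w -> E w') ->
  depends_on A E.
Proof.
move=> H w w' ww'; apply/propext; split; first exact: H.
by apply: H => i Ai; rewrite ww'.
Qed.

Lemma depends_on_comp {S T : Type} (g : S -> T) A (F : (I -> bool) -> S) :
  depends_on A F -> depends_on A (fun w => g (F w)).
Proof. by move=> FA w w' ww'; rewrite (FA _ _ ww'). Qed.

Lemma depends_on_indic A (E : set (I -> bool)) :
  depends_on A E -> depends_on A (\1_E : _ -> R).
Proof.
move=> EA w w' ww'; rewrite !indicE.
have -> // : (w \in E) = (w' \in E).
by apply/idP/idP; rewrite !in_setE (EA _ _ ww').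
Qed.

Lemma depends_onS {T : Type} A B (F : (I -> bool) -> T) :
  A `<=` B -> depends_on A F -> depends_on B F.
Proof. by move=> AB FA w w' ww'; apply: FA => i /AB; exact: ww'. Qed.

Lemma indic_le (E E' : set (I -> bool)) w : (E w -> E' w) ->
  \1_E w <= \1_E' w :> R.
Proof.
move=> EE'; rewrite !indicE ler_nat; case: (asboolP (E w)) => Ew.
  by rewrite !mem_set//; exact: EE'.
by rewrite memNset.
Qed.

Lemma indic1 (E : set (I -> bool)) w : E w -> \1_E w = 1 :> R.
Proof. by move=> Ew; rewrite indicE mem_set. Qed.

Lemma indic0' (E : set (I -> bool)) w : ~ E w -> \1_E w = 0 :> R.
Proof. by move=> Ew; rewrite indicE memNset. Qed.

Lemma indic_ge0 (E : set (I -> bool)) w : 0 <= \1_E w :> R.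
Proof. by rewrite indicE. Qed.

Lemma indic_le1 (E : set (I -> bool)) w : \1_E w <= 1 :> R.
Proof. by rewrite indicE lern1 leq_b1. Qed.

Lemma increasing_indic E : increasing_event E -> increasing_rv (\1_E).
Proof. by move=> incE w w' ww'; apply: indic_le; exact: incE. Qed.

Lemma eq_expect r D F G w : F =1 G -> expect r D F w = expect r D G w.
Proof. by move=> FG; congr expect; apply/funext. Qed.

Lemma eq_expect_weight r r' D F w : {in D, r =1 r'} ->
  expect r D F w = expect r' D F w.
Proof.
elim: D w => //= i D IH w rr'; rewrite rr' ?mem_head// !IH// => j jD;
  by rewrite rr'// in_cons jD orbT.
Qed.

Lemma expect_cst r D c w : expect r D (fun=> c) w = c.
Proof. by elim: D w => //= i D IH w; rewrite !IH; ring. Qed.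

Lemma expectD r D F G w :
  expect r D (fun w => F w + G w) w = expect r D F w + expect r D G w.
Proof. by elim: D w => //= i D IH w; rewrite !IH; ring. Qed.

Lemma expectZ r D c F w :
  expect r D (fun w => c * F w) w = c * expect r D F w.
Proof. by elim: D w => //= i D IH w; rewrite !IH; ring. Qed.

Lemma expectB r D F G w :
  expect r D (fun w => F w - G w) w = expect r D F w - expect r D G w.
Proof. by elim: D w => //= i D IH w; rewrite !IH; ring. Qed.

Lemma expect_sum r D (J : Type) (s : seq J) (F : J -> (I -> bool) -> R) w :
  expect r D (fun w => \sum_(j <- s) F j w) w = \sum_(j <- s) expect r D (F j) w.
Proof.
elim: s => [|j s IH].
  by rewrite big_nil -[RHS](expect_cst r D 0 w); apply: eq_expect => v; rewrite big_nil.
by rewrite big_cons -IH -expectD; apply: eq_expect => v; rewrite big_cons.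
Qed.

Lemma le_expect r D F G w : is_prob r -> (forall w, F w <= G w) ->
  expect r D F w <= expect r D G w.
Proof.
move=> rP FG; elim: D w => //= i D IH w; have /andP[r0 r1] := rP i.
by apply: lerD; apply: ler_wpM2l => //; lra.
Qed.

Lemma expect_ge0 r D F w : is_prob r -> (forall w, 0 <= F w) ->
  0 <= expect r D F w.
Proof. by move=> rP F0; rewrite -(expect_cst r D 0 w); exact: le_expect. Qed.

Lemma prob_ge0 r D E w : is_prob r -> 0 <= prob r D E w.
Proof. by move=> rP; apply: expect_ge0 => // v; exact: indic_ge0. Qed.

Lemma prob_le1 r D E w : is_prob r -> prob r D E w <= 1.
Proof.
by move=> rP; rewrite -(expect_cst r D 1 w); exact: le_expect.
Qed.

Lemma le_prob r D (E E' : set (I -> bool)) w : is_prob r -> E `<=` E' ->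
  prob r D E w <= prob r D E' w.
Proof. by move=> rP EE'; apply: le_expect => // v; apply: indic_le; exact: EE'. Qed.

Lemma prob_setC r D E w : prob r D (~` E) w = 1 - prob r D E w.
Proof.
rewrite -[X in X - _](expect_cst r D 1 w) -expectB; apply: eq_expect => v.
by rewrite !indicE in_setC; case: (v \in E); rewrite ?subr0 ?subrr.
Qed.

Lemma prob_setU r D E E' w :
  prob r D (E `|` E') w + prob r D (E `&` E') w = prob r D E w + prob r D E' w.
Proof.
rewrite -!expectD; apply: eq_expect => v.
by rewrite !indicE in_setU in_setI; case: (v \in E); case: (v \in E');
  rewrite //= ?addr0 ?add0r.
Qed.

Lemma expect_cat r D D' F w :
  expect r (D ++ D') F w = expect r D (expect r D' F) w.
Proof. by elim: D w => //= i D IH w; rewrite !IH. Qed.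

Lemma depends_on_expect r D A F : depends_on A F -> depends_on A (expect r D F).
Proof.
move=> FA; elim: D => //= i D IH w w' ww'.
by congr (_ * _ + _ * _); apply: IH => j Aj; rewrite /upd; case: eqP => // _;
  exact: ww'.
Qed.

Lemma expect_frozen r D F w w' : (forall i, i \notin D -> w i = w' i) ->
  expect r D F w = expect r D F w'.
Proof.
elim: D w w' => /= [|i D IH] w w' ww'.
  by congr F; apply/funext => i; exact: ww'.
by congr (_ * _ + _ * _); apply: IH => j jD; rewrite /upd; case: eqP => // /eqP ji;
  apply: ww'; rewrite in_cons negb_or ji.
Qed.

Lemma expect_updN r D F w i b : i \notin D ->
  expect r D (fun w => F (upd w i b)) w = expect r D F (upd w i b).
Proof.
elim: D w => //= j D IH w; rewrite in_cons negb_or => /andP[ij iD].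
by rewrite !IH// ![upd (upd w j _) i b]updC // eq_sym.
Qed.

Lemma expect_filter r D (A : set I) F w : depends_on A F ->
  expect r D F w = expect r [seq i <- D | i \in A] F w.
Proof.
move=> FA; elim: D w => //= i D IH w.
case: ifPn => [_ /=|]; first by rewrite !IH.
rewrite notin_setE -IH => Ai.
rewrite !(depends_on_upd _ _ (depends_on_expect r D FA) Ai); ring.
Qed.

Lemma expect_swap r D D' F w i : uniq (i :: D ++ D') ->
  expect r (i :: D ++ D') F w = expect r (D ++ i :: D') F w.
Proof.
elim: D w => // j D IH w /= /andP[]; rewrite in_cons negb_or => /andP[ij iD].
move=> /andP[jD uD].
rewrite -!IH /=; [|by rewrite iD uD..].
rewrite ![upd (upd w i _) j _]updC//; ring.
Qed.

Lemma expect_perm r D D' F w : uniq D -> perm_eq D D' ->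
  expect r D F w = expect r D' F w.
Proof.
elim: D D' w => [|i D IH] D' w uD DD'; first by move: DD'; rewrite perm_sym => /perm_nilP ->.
have iD' : i \in D' by rewrite -(perm_mem DD') mem_head.
have uD' : uniq D' by rewrite -(perm_uniq DD').
case/splitPr: iD' DD' uD' => D1 D2 DD' uD'.
have uiD : uniq (i :: D1 ++ D2) by rewrite -(uniq_catCA D1 [:: i]).
rewrite -expect_swap //=.
have DD : perm_eq D (D1 ++ D2).
  by rewrite -(perm_cons i); apply: (perm_trans DD'); rewrite (perm_catCA D1 [:: i]).
by move: uD => /andP[_ uD]; congr (_ * _ + _ * _); exact: IH.
Qed.

Lemma eq_expect_sites r D D' A F w w' : uniq D -> uniq D' -> depends_on A F ->
  (forall i, A i -> i \in D) -> (forall i, A i -> i \in D') ->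
  expect r D F w = expect r D' F w'.
Proof.
move=> uD uD' FA AD AD'.
transitivity (expect r D' F w); last first.
  pose w'' i := if i \in D' then w i else w' i.
  rewrite (@expect_frozen r D' F w' w'') => [|i iD']; last first.
    by rewrite /w'' (negbTE iD').
  by apply: (depends_on_expect r D' FA) => i /AD' iD'; rewrite /w'' iD'.
rewrite (expect_filter r D w FA) (expect_filter r D' w FA).
apply: expect_perm; first exact: filter_uniq.
apply: uniq_perm; rewrite ?filter_uniq// => i; rewrite !mem_filter.
by case: (boolP (i \in A)) => //= /set_mem Ai; rewrite AD// AD'.
Qed.

Lemma expect_indep r D A F G w : depends_on A F -> depends_on (~` A) G ->
  expect r D (fun w => F w * G w) w = expect r D F w * expect r D G w.
Proof.
move=> FA GA; elim: D w => //= i D IH w; rewrite !IH.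
have [Ai|Ai] := pselect (A i).
  rewrite !(depends_on_upd _ _ (depends_on_expect r D GA)); [ring|by move=> /(_ Ai)..].
rewrite !(depends_on_upd _ _ (depends_on_expect r D FA) Ai); ring.
Qed.

Lemma increasing_expect r D F : is_prob r -> increasing_rv F ->
  increasing_rv (expect r D F).
Proof.
move=> rP incF; elim: D => //= i D IH w w' ww'; have /andP[r0 r1] := rP i.
by apply: lerD; apply: ler_wpM2l => //; [|lra|]; apply: IH; exact: config_le_upd.
Qed.

(** By induction on the sites: the covariance is the mean of the covariances conditional on the
    state of [i], plus the covariance of the two conditional means, which both increase with that
    state. *)
Lemma harris r D F G w : is_prob r -> increasing_rv F -> increasing_rv G ->
  expect r D F w * expect r D G w <= expect r D (fun w => F w * G w) w.
Proof.
move=> rP incF incG; elim: D w => //= i D IH w; have /andP[r0 r1] := rP i.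
have lew : config_le (upd w i false) (upd w i true) by exact: config_le_upd.
have := increasing_expect D rP incF lew; have := increasing_expect D rP incG lew.
have := IH (upd w i true); have := IH (upd w i false).
set a1 := expect r D F _; set b1 := expect r D G _; set c1 := expect r D _ _.
set a0 := expect r D F _; set b0 := expect r D G _; set c0 := expect r D _ _.
move=> h0 h1 hb ha.
have h0' : (1 - r i) * (a1 * b1) <= (1 - r i) * c1 by apply: ler_wpM2l => //; lra.
have h1' : r i * (a0 * b0) <= r i * c0 by apply: ler_wpM2l.
have : 0 <= r i * (1 - r i) * ((a0 - a1) * (b0 - b1)).
  by apply: mulr_ge0; apply: mulr_ge0; lra.
nra.
Qed.

(** One site at a time: raising [r i] moves weight from the conditional mean with [i] closed to the
    one with [i] open, which is at least as large. *)
Lemma le_expect_weight r r' D F w : is_prob r -> is_prob r' ->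
  (forall i, r i <= r' i) -> increasing_rv F -> expect r D F w <= expect r' D F w.
Proof.
move=> rP rP' rr' incF; elim: D w => //= i D IH w.
have /andP[r0 r1] := rP i; have /andP[r0' r1'] := rP' i.
have := IH (upd w i true); have := IH (upd w i false).
have : config_le (upd w i false) (upd w i true) by exact: config_le_upd.
move=> /(increasing_expect D rP' incF); have := rr' i.
set a1 := expect r D F _; set b1 := expect r' D F _.
set a0 := expect r D F _; set b0 := expect r' D F _ => *.
have : (1 - r i) * a1 <= (1 - r i) * b1 by apply: ler_wpM2l => //; lra.
have : r i * a0 <= r i * b0 by apply: ler_wpM2l.
have : 0 <= (r' i - r i) * (b0 - b1) by apply: mulr_ge0; lra.
nra.
Qed.

(* Domain Markov property: a random set [K] explored by revealing only sites
   of [A k] when [K = k] leaves the other sites with their original law. *)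
Lemma expect_explore r D (T : eqType) (K : (I -> bool) -> T) (A : T -> set I)
    (H : T -> (I -> bool) -> R) w :
  (forall k, depends_on (A k) (fun w => K w == k)) ->
  (forall k, depends_on (~` A k) (H k)) ->
  expect r D (fun v => H (K v) v) w =
  expect r D (fun v => expect r D (H (K v)) w) w.
Proof.
move=> KA HA.
have [ks kuniq kE] : exists2 ks : seq T, uniq ks & forall F,
    expect r D F w = \sum_(k <- ks) expect r D (fun v => (K v == k)%:R * F v) w.
  (* The claim is made for every duplicate-free list containing the relevant values of [K], so that
     the induction can concatenate the lists obtained for the two states of a site. *)
  suff [ks ksP] : exists ks : seq T, forall ks', uniq ks' -> {subset ks <= ks'} ->
      forall F, expect r D F w =
        \sum_(k <- ks') expect r D (fun v => (K v == k)%:R * F v) w.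
    exists (undup ks); first exact: undup_uniq.
    by move=> F; apply: ksP => [|k]; [exact: undup_uniq|rewrite mem_undup].
  elim: D w => [w|i D IH w] /=.
    exists [:: K w] => ks' uks' sub F.
    rewrite (bigD1_seq (K w)) ?sub ?mem_head//= eqxx mul1r big1 ?addr0// => k.
    by rewrite eq_sym => /negbTE ->; rewrite mul0r.
  have [ks1 ks1P] := IH (upd w i true); have [ks2 ks2P] := IH (upd w i false).
  exists (ks1 ++ ks2) => ks' uks' sub F.
  rewrite big_split/= -!mulr_sumr -ks1P// -?ks2P// => k kk;
    by apply: sub; rewrite mem_cat kk ?orbT.
rewrite kE [RHS]kE; apply: eq_bigr => k _.
transitivity (expect r D (fun v => (K v == k)%:R * H k v) w).
  by apply: eq_expect => v; case: eqP => [->//|]; rewrite !mul0r.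
rewrite (expect_indep _ _ _ (depends_on_comp (fun b : bool => b%:R) (KA k)) (HA k)).
rewrite mulrC -expectZ.
by apply: eq_expect => v; rewrite mulrC; case: eqP => [->//|]; rewrite !mul0r.
Qed.

(** Russo's formula for an arbitrary [F]: the mean is affine in the density of each site, with slope
    the mean effect of opening that site. *)
Lemma is_derive_expect D F w (t : R) : uniq D ->
  is_derive t 1 (fun t : R => expect (fun=> t) D F w)
   (\sum_(i <- D) expect (fun=> t) D
      (fun v => F (upd v i true) - F (upd v i false)) w).
Proof.
elim: D F w => [|i D IH] F w /=.
  by move=> _; rewrite big_nil; exact: is_derive_cst.
move=> /andP[iD uD].
have d1 := IH F (upd w i true) uD; have d0 := IH F (upd w i false) uD.
apply: is_derive_eq.
rewrite big_cons !expectB !expect_updN// !upd_upd /=.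
rewrite /GRing.scale/= big_split/= -!mulr_sumr.
ring.
Qed.

End FiniteProduct.

(** * Symmetries of product measures, and the effect of raising the density on a block *)

Section FiniteProductSymmetry.
Context {R : realType} {I : eqType}.
Implicit Types (r : I -> R) (D : seq I) (w : I -> bool) (F : (I -> bool) -> R).

Lemma expect_map r D (f g : I -> I) F w : cancel f g -> cancel g f ->
  expect r (map f D) F w = expect (r \o f) D (fun v => F (v \o g)) (w \o f).
Proof.
move=> fK gK.
have updf v i b : upd v (f i) b \o f = upd (v \o f) i b.
  by apply/funext => j; rewrite /upd /= (can_eq fK).
elim: D w => /= [|i D IH] w; last by rewrite !IH !updf.
by congr F; apply/funext => i /=; rewrite gK.
Qed.

(** Exchanging open and closed turns questions on closed paths into questions on open ones at the
    complementary densities. *)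
Lemma expect_negb r D F w :
  expect r D F w =
  expect (fun i => 1 - r i) D (fun v => F (fun i => ~~ v i)) (fun i => ~~ w i).
Proof.
elim: D w => /= [|i D IH] w.
  by congr F; apply/funext => i; rewrite negbK.
have updN b : (fun j => ~~ upd w i b j) = upd (fun j => ~~ w j) i (~~ b).
  by apply/funext => j; rewrite /upd; case: eqP.
by rewrite !IH !updN /= opprB addrCA subrr addr0 addrC.
Qed.

Lemma harris_prob r D (E E' : set (I -> bool)) w : is_prob r ->
  increasing_event E -> increasing_event E' ->
  prob r D E w * prob r D E' w <= prob r D (E `&` E') w.
Proof.
move=> rP incE incE'.
apply: le_trans (harris _ _ rP (increasing_indic incE) (increasing_indic incE')) _.
by apply: le_expect => // v; rewrite indicI.
Qed.

Lemma prob_indep r D A (E E' : set (I -> bool)) w :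
  depends_on A E -> depends_on (~` A) E' ->
  prob r D (E `&` E') w = prob r D E w * prob r D E' w.
Proof.
move=> EA EA'.
rewrite -(expect_indep _ _ _ (depends_on_indic EA) (depends_on_indic EA')).
by apply: eq_expect => v; rewrite indicI.
Qed.

Definition set_block (B : seq I) (b : bool) w : I -> bool :=
  fun i => if i \in B then b else w i.

(* Couple the two laws on the block: with probability at least [(q' - q) ^ |B|]
   all of [B] is closed under the first one and open under the second one. *)
Lemma expect_block_drop (q q' : R) r r' (B : seq I) F w w' :
  0 <= q -> q <= q' -> q' <= 1 -> uniq B ->
  {in B, forall i, r i = q} -> {in B, forall i, r' i = q'} ->
  is_prob r -> is_prob r' -> (forall i, r i <= r' i) ->
  decreasing_rv F -> config_le w w' ->
  (q' - q) ^+ size B * (F (set_block B false w) - F (set_block B true w')) <=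
  expect r B F w - expect r' B F w'.
Proof.
move=> q0 qq' q1 + + + rP rP' rr' decF.
have decE v v' s : config_le v v' -> expect r' s F v' <= expect r s F v.
  have incNF : increasing_rv (fun v => -1 * F v).
    by move=> u u' uu'; have := decF _ _ uu'; lra.
  move=> vv'.
  have := le_expect_weight s v rP rP' rr' incNF.
  have := increasing_expect s rP' incNF vv'.
  rewrite !expectZ; lra.
elim: B w w' => [|i B IH] w w' uB rB rB' ww' /=.
  by rewrite expr0 mul1r.
have iB : i \notin B by case/andP: uB.
have ri : r i = q by apply: rB; rewrite mem_head.
have ri' : r' i = q' by apply: rB'; rewrite mem_head.
have ww'' : config_le (upd w i false) (upd w' i true) by exact: config_le_upd.
have := IH _ _ _ _ _ ww''.
have -> : set_block B false (upd w i false) = set_block (i :: B) false w.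
  apply/funext => j; rewrite /set_block /upd in_cons.
  by case: eqP => //= ->; rewrite (negbTE iB).
have -> : set_block B true (upd w' i true) = set_block (i :: B) true w'.
  apply/funext => j; rewrite /set_block /upd in_cons.
  by case: eqP => //= ->; rewrite (negbTE iB).
move=> h.
have {h} : (q' - q) ^+ (size B).+1 *
    (F (set_block (i :: B) false w) - F (set_block (i :: B) true w')) <=
    (q' - q) * (expect r B F (upd w i false) - expect r' B F (upd w' i true)).
  rewrite exprS -mulrA; apply: ler_wpM2l; first by rewrite subr_ge0.
  apply: h; first by case/andP: uB.
    by move=> j jB; apply: rB; rewrite in_cons jB orbT.
  by move=> j jB; apply: rB'; rewrite in_cons jB orbT.
have leT : config_le (upd w i true) (upd w' i true) by exact: config_le_upd.
have leF : config_le (upd w i false) (upd w' i false) by exact: config_le_upd.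
have := decE _ _ B leT; have := decE _ _ B leF.
rewrite ri ri'.
set a1 := expect r B F (upd w i true); set a0 := expect r B F (upd w i false).
set b1 := expect r' B F (upd w' i true).
set b0 := expect r' B F (upd w' i false) => h0 h1 h.
(* The site [i] is open under both laws with weight [q], closed under both with weight [1 - q'], and
   closed under the first but open under the second with weight [q' - q]; the induction hypothesis
   bounds the last case. *)
have : 0 <= q * (a1 - b1) by apply: mulr_ge0 => //; lra.
have : 0 <= (1 - q') * (a0 - b0) by apply: mulr_ge0 => //; lra.
nra.
Qed.

End FiniteProductSymmetry.

(** * Connection by walks, first entrances and last exits *)

Section Connectivity.
Implicit Types (S A B C : set vertex) (x y z u v : vertex) (w : configuration).

Lemma lattice_adjE u v : lattice_adj u v =
  [|| (v.1 == u.1 + 1) && (v.2 == u.2), (v.1 == u.1 - 1) && (v.2 == u.2),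
      (v.1 == u.1) && (v.2 == u.2 + 1), (v.1 == u.1) && (v.2 == u.2 - 1),
      (v.1 == u.1 + 1) && (v.2 == u.2 - 1) | (v.1 == u.1 - 1) && (v.2 == u.2 + 1)].
Proof. by case: v => a b; rewrite /lattice_adj /neighbors !inE !xpair_eqE. Qed.

Lemma lattice_adj_sym u v : lattice_adj u v = lattice_adj v u.
Proof. rewrite !lattice_adjE; lia. Qed.

(** Walks may repeat vertices, which makes them easy to concatenate and reverse; [site_clusterE]
    recovers paths with distinct vertices. *)
Inductive conn S x : vertex -> Prop :=
| conn_refl : S x -> conn S x x
| conn_rcons y z : conn S x y -> lattice_adj y z -> S z -> conn S x z.

Lemma conn_start S x y : conn S x y -> S x.
Proof. by elim. Qed.

Lemma conn_end S x y : conn S x y -> S y.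
Proof. by case. Qed.

Lemma conn_trans S x y z : conn S x y -> conn S y z -> conn S x z.
Proof. by move=> xy; elim=> // u v _ xu uv; exact: (conn_rcons xu). Qed.

Lemma conn_adj S x y : S x -> S y -> lattice_adj x y -> conn S x y.
Proof. by move=> Sx Sy xy; exact: conn_rcons (conn_refl Sx) xy Sy. Qed.

Lemma conn_sym S x y : conn S x y -> conn S y x.
Proof.
elim=> [|u v xu ux uv Sv]; first exact: conn_refl.
apply: conn_trans ux; apply: conn_adj => //; first exact: conn_end xu.
by rewrite lattice_adj_sym.
Qed.

Lemma conn_sub S S' x y : S `<=` S' -> conn S x y -> conn S' x y.
Proof.
move=> SS'; elim=> [/SS'|u v _ xu uv /SS' Sv]; first exact: conn_refl.
exact: conn_rcons xu uv Sv.
Qed.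

Lemma conn_invariant S C x y : conn S x y -> C x ->
  (forall u v, C u -> lattice_adj u v -> S v -> C v) -> C y.
Proof. by move=> + Cx H; elim=> // u v _ Cu uv; exact: H uv. Qed.

Lemma conn_cluster S x y : conn S x y -> conn [set u | conn S x u] x y.
Proof.
elim=> [Sx|u v xu IH uv Sv]; first exact/conn_refl/conn_refl.
exact: conn_rcons IH uv (conn_rcons xu uv Sv).
Qed.

Lemma conn_avoid_or_enter S B x y : conn S x y -> ~ B x ->
  conn (S `\` B) x y \/
  exists u v, [/\ conn (S `\` B) x u, lattice_adj u v, B v & S v].
Proof.
move=> + Bx; elim=> [Sx|u v xu [IH|IH] uv Sv]; [by left; exact: conn_refl| |by right].
have [Bv|Bv] := pselect (B v); first by right; exists u, v; split.
by left; exact: conn_rcons IH uv _.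
Qed.

(** The walk is stopped at its first entrance into [B]. *)
Lemma conn_enter S B x y : conn S x y -> ~ B x -> B y ->
  exists u v, [/\ conn (S `\` B) x u, lattice_adj u v, B v & S v].
Proof.
by move=> xy Bx By; have [/conn_end[]|] := conn_avoid_or_enter xy Bx.
Qed.

(** Last exit from [B]: the first entrance of the reversed walk. *)
Lemma conn_exit S B x y : conn S x y -> B x -> ~ B y ->
  exists u v, [/\ B u, S u, lattice_adj u v & conn (S `\` B) v y].
Proof.
move=> /conn_sym yx Bx By.
have [u [v [yu uv Bv Sv]]] := conn_enter yx By Bx.
by exists v, u; split; rewrite 1?lattice_adj_sym//; exact: conn_sym.
Qed.

Lemma conn_pathP S x y : conn S x y <->
  exists s, [/\ path lattice_adj x s, (forall z, z \in x :: s -> S z) & last x s = y].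
Proof.
split=> [|[s [xs]]].
  elim=> [Sx|u v _ [s [xs sS su]] uv Sv].
    by exists [::]; split=> // z; rewrite inE => /eqP ->.
  exists (rcons s v); split; rewrite ?rcons_path ?last_rcons ?xs ?su//.
  by move=> z; rewrite -rcons_cons mem_rcons inE => /orP[/eqP ->//|/sS].
elim/last_ind: s y xs => [|s v IH] y.
  by move=> _ S0 <-; apply: conn_refl; apply: S0; rewrite mem_head.
rewrite rcons_path last_rcons => /andP[xs sv] Ss <-.
apply: conn_rcons sv (Ss _ _); last by rewrite -rcons_cons mem_rcons mem_head.
by apply: IH => // z zs; apply: Ss; rewrite -rcons_cons mem_rcons in_cons zs orbT.
Qed.

(** Erasing the loops of a walk leaves a path. *)
Lemma site_clusterE (S : pred vertex) x : site_cluster S x = conn (fun u => S u) x.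
Proof.
apply/funext => y; apply/propext; split=> [[s [/andP[xs _] /allP sS sy]]|].
  by apply/conn_pathP; exists s; split.
move=> /conn_pathP[s [xs sS <-]].
case: (shortenP xs) => s' xs' us' ss'; exists s'; split=> //.
  by apply/andP.
apply/allP => z; rewrite inE => /orP[/eqP ->|/ss' zs]; apply: sS.
  exact: mem_head.
by rewrite in_cons zs orbT.
Qed.

Lemma conn_map S S' (f : vertex -> vertex) x y :
  (forall u v, lattice_adj u v -> lattice_adj (f u) (f v)) ->
  (forall u, S u -> S' (f u)) -> conn S x y -> conn S' (f x) (f y).
Proof.
move=> fadj SS'; elim=> [/SS'|u v _ xu uv /SS' Sv]; first exact: conn_refl.
exact: conn_rcons xu (fadj _ _ uv) Sv.
Qed.

Definition conn_in A w x y : Prop := conn (A `&` [set u | w u]) x y.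

Lemma conn_in_dep A x y : depends_on A (fun w => conn_in A w x y).
Proof.
apply: depends_on_prop => w w' ww'; apply: conn_sub => u [Au wu].
by split=> //=; rewrite -ww'.
Qed.

Lemma conn_in_mono A A' w w' x y : A `<=` A' -> config_le w w' ->
  conn_in A w x y -> conn_in A' w' x y.
Proof. by move=> AA' ww'; apply: conn_sub => u [/AA' ? /ww']. Qed.

Definition connects A (X Y : set vertex) : set configuration :=
  [set w | exists x y, [/\ X x, Y y & conn_in A w x y]].

Lemma connects_dep A X Y : depends_on A (connects A X Y).
Proof.
apply: depends_on_prop => w w' ww' [x [y [Xx Yy xy]]]; exists x, y; split=> //.
by rewrite -(conn_in_dep x y ww').
Qed.

Lemma connects_inc A X Y : increasing_event (connects A X Y).
Proof.
move=> w w' ww' [x [y [Xx Yy xy]]]; exists x, y; split=> //.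
exact: conn_in_mono xy.
Qed.

Lemma connectsS A A' X X' Y Y' : A `<=` A' -> X `<=` X' -> Y `<=` Y' ->
  connects A X Y `<=` connects A' X' Y'.
Proof.
move=> AA' XX' YY' w [x [y [/XX' Xx /YY' Yy xy]]]; exists x, y; split=> //.
by apply: conn_in_mono xy => // u.
Qed.

End Connectivity.

(** * Boxes and spheres for the maximum norm *)

Section Boxes.

Definition norm (v : vertex) : nat := maxn `|v.1| `|v.2|.

Definition vadd (u v : vertex) : vertex := (u.1 + v.1, u.2 + v.2).
Definition vsub (u v : vertex) : vertex := (u.1 - v.1, u.2 - v.2).

Definition box (c : vertex) (n : nat) : set vertex := [set v | (norm (vsub v c) <= n)%N].

Definition sphere (n : nat) : set vertex := [set v | norm v = n].

Definition box_seq (n : nat) : seq vertex :=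
  let s := [seq (k%:Z - n%:Z) | k <- iota 0 n.*2.+1] in
  [seq (a, b) | a <- s, b <- s].

Lemma mem_box_seq n v : (v \in box_seq n) = (norm v <= n)%N.
Proof.
have memE (a : int) : (a \in [seq (k%:Z - n%:Z) | k <- iota 0 n.*2.+1]) = (`|a| <= n)%N.
  apply/mapP/idP => [[k]|an]; first by rewrite mem_iota; lia.
  by exists `|(a + n%:Z)%R|%N; rewrite ?mem_iota; lia.
case: v => a b; rewrite /norm geq_max /=.
by apply/allpairsP/andP => [[[c d]] /= []|[an bn]];
  [rewrite !memE => an bn [-> ->]|exists (a, b); rewrite /= !memE].
Qed.

Lemma box_seq_uniq n : uniq (box_seq n).
Proof.
have us : uniq [seq (k%:Z - n%:Z) | k <- iota 0 n.*2.+1].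
  by rewrite map_inj_uniq ?iota_uniq// => a b; lia.
by apply: allpairs_uniq => // -[a b] [c d] _ _ [-> ->].
Qed.

Lemma norm_adj u v : lattice_adj u v -> (norm v <= (norm u).+1)%N.
Proof. rewrite lattice_adjE /norm; lia. Qed.

Lemma norm_sub_adj c u v : lattice_adj u v ->
  (norm (vsub v c) <= (norm (vsub u c)).+1)%N.
Proof. rewrite lattice_adjE /norm /vsub /=; lia. Qed.

Lemma box_boundaryE n : box_boundary n = sphere n.
Proof. by apply/seteqP; split=> v; rewrite /box_boundary /sphere /norm /=; lia. Qed.

End Boxes.

(** * Planarity: a horizontal and a vertical crossing of a rectangle meet *)

Section Crossing.
Implicit Types (u v z : vertex) (s : seq vertex).

(* Whether the edge [u, v] meets the half-line which starts at height [z.2 + 1/2]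
   above [z] and goes to the left. *)
Definition crosses z u v : bool :=
  [&& u.2 == z.2, v.2 == z.2 + 1 & u.1 <= z.1] ||
  [&& v.2 == z.2, u.2 == z.2 + 1 & v.1 <= z.1].

Fixpoint crossing_parity z u s : bool :=
  if s is v :: s' then crosses z u v (+) crossing_parity z v s' else false.

(** A potential on vertices: when the half-line moves from [z] to a neighbour [z'], the change of
    [crosses] on an edge avoiding both is the difference of this potential between its ends. *)
Definition left_of_upper z z' u : bool :=
  if z.2 < z'.2 then (u.2 == z'.2) && (u.1 <= z'.1)
  else if z'.2 < z.2 then (u.2 == z.2) && (u.1 <= z.1) else false.

Lemma crossesC z u v : crosses z u v = crosses z v u.
Proof. by rewrite /crosses orbC. Qed.

(** No vertex of the row lies strictly between [z] and [z'], so the other vertices of the row are on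
    the same side of both. *)
Lemma crosses_row z z' u v : z.2 = z'.2 -> lattice_adj z z' ->
  u != z -> u != z' -> v != z -> v != z' -> crosses z u v = crosses z' u v.
Proof.
move=> e zz'; rewrite /crosses e.
have H t : t != z -> t != z' -> t.2 = z'.2 -> (t.1 <= z.1) = (t.1 <= z'.1).
  move: zz' e; rewrite lattice_adjE; case: z z' t => [? ?] [? ?] [? ?].
  by rewrite !xpair_eqE /=; lia.
move=> uz uz' vz vz'; congr (_ || _).
  by case: eqP => //= /H ->.
by case: eqP => //= /H ->.
Qed.

Lemma crosses_rows z z' u v : z'.2 = z.2 + 1 -> lattice_adj z z' -> lattice_adj u v ->
  u != z -> u != z' -> v != z -> v != z' -> u.2 = z'.2 ->
  crosses z u v (+) crosses z' u v =
  (u.1 <= z'.1) (+) ((v.2 == z'.2) && (v.1 <= z'.1)).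
Proof.
move=> e zz' uv uz uz' vz vz' eu.
have /orP[/eqP ev|/orP[/eqP ev|/eqP ev]] :
    (v.2 == u.2) || ((v.2 == u.2 + 1) || (v.2 == u.2 - 1)).
- by move: uv; rewrite lattice_adjE; lia.
- have -> : (v.1 <= z'.1) = (u.1 <= z'.1).
    move: uv uz' vz' eu ev; rewrite lattice_adjE; case: v u z' {e zz' uz vz} => [? ?] [? ?] [? ?].
    by rewrite !xpair_eqE /=; lia.
  by rewrite /crosses ev eu e; do !(case: eqP => ? /=; first lia); rewrite ?eqxx ?addbb.
- rewrite /crosses ev eu e eqxx.
  by do !(case: eqP => ? /=; first lia); rewrite ?eqxx /= ?addbF ?orbF; lia.
(* Here [v] is one row lower: the edges from [z] to [z'] and from [v] to [u] are disjoint, join the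
   same two rows and do not cross, so they are ordered alike at both ends. *)
- have -> : (u.1 <= z'.1) = (v.1 <= z.1).
    move: uv zz' uz' vz eu ev e; rewrite !lattice_adjE.
    case: v u z z' {uz vz'} => [? ?] [? ?] [? ?] [? ?].
    by rewrite !xpair_eqE /=; lia.
  by rewrite /crosses ev eu e eqxx; do !(case: eqP => ? /=; first lia); lia.
Qed.

Lemma crossing_parity_step_up z z' u v : z.2 <= z'.2 ->
  lattice_adj z z' -> lattice_adj u v ->
  u != z -> u != z' -> v != z -> v != z' ->
  crosses z u v (+) crosses z' u v = left_of_upper z z' u (+) left_of_upper z z' v.
Proof.
move=> le zz' uv uz uz' vz vz'; rewrite /left_of_upper.
case: ltgtP le => // [lt _|e _]; last by rewrite (crosses_row e)// addbb.
have e : z'.2 = z.2 + 1 by move: zz'; rewrite lattice_adjE; lia.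
case: (eqVneq u.2 z'.2) => [eu|nu] /=; first exact: crosses_rows.
case: (eqVneq v.2 z'.2) => [ev|nv] /=.
  rewrite crossesC [crosses z' u v]crossesC crosses_rows//; last by rewrite lattice_adj_sym.
  by rewrite (negbTE nu) addbF.
by rewrite /crosses (negbTE nu) (negbTE nv) -e (negbTE nu) (negbTE nv) /= !andbF.
Qed.

Lemma crossing_parity_step z z' u v :
  lattice_adj z z' -> lattice_adj u v ->
  u != z -> u != z' -> v != z -> v != z' ->
  crosses z u v (+) crosses z' u v = left_of_upper z z' u (+) left_of_upper z z' v.
Proof.
move=> zz' uv uz uz' vz vz'.
have [le|/ltW le] := leP z.2 z'.2; first exact: crossing_parity_step_up.
rewrite addbC crossing_parity_step_up//; last by rewrite lattice_adj_sym.
by rewrite /left_of_upper; case: ltgtP.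
Qed.

(** The changes telescope along the path, leaving the potential at its two ends. *)
Lemma crossing_parity_adj z z' u s : lattice_adj z z' -> path lattice_adj u s ->
  z \notin u :: s -> z' \notin u :: s ->
  crossing_parity z u s (+) crossing_parity z' u s =
  left_of_upper z z' u (+) left_of_upper z z' (last u s).
Proof.
move=> zz'; elim: s u => [|v s IH] u /=; first by rewrite addbb.
move=> /andP[uv vs]; rewrite in_cons negb_or => /andP[zu zs].
rewrite in_cons negb_or => /andP[zu' zs'].
rewrite addbACA IH// crossing_parity_step// 1?eq_sym//.
- by rewrite -addbA addKb.
- by move: zs; rewrite in_cons negb_or => /andP[].
- by move: zs'; rewrite in_cons negb_or => /andP[].
Qed.

(** A crossing requires a vertex in the row of [z] with abscissa at most [z.1]; only [z] itself
    could be one. *)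
Lemma crossing_parity_left z u s : z \notin u :: s ->
  {in u :: s, forall v, z.1 <= v.1} -> crossing_parity z u s = false.
Proof.
have H v : z != v -> z.1 <= v.1 -> (v.2 == z.2) && (v.1 <= z.1) = false.
  by case: z v => [a b] [c d]; rewrite xpair_eqE /=; lia.
elim: s u => //= v s IH u; rewrite in_cons negb_or => /andP[zu zs] le.
rewrite IH//; last by move=> t ts; apply: le; rewrite in_cons ts orbT.
have zv : z != v by move: zs; rewrite in_cons negb_or => /andP[].
have := H _ zu (le _ (mem_head _ _)).
have := H _ zv (le _ _); rewrite !inE eqxx orbT => /(_ isT).
rewrite /crosses; lia.
Qed.

(** Every passage between the rows [z.2] and [z.2 + 1] is counted, so the parity tells whether the
    ends lie on different sides. *)
Lemma crossing_parity_right z u s : path lattice_adj u s ->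
  {in u :: s, forall v, v.1 <= z.1} ->
  crossing_parity z u s = (u.2 <= z.2) (+) ((last u s).2 <= z.2).
Proof.
elim: s u => [|v s IH] u /=; first by rewrite addbb.
move=> /andP[uv vs] le.
rewrite IH//; last by move=> t ts; apply: le; rewrite in_cons ts orbT.
have := le u (mem_head _ _); have := le v; rewrite !inE eqxx orbT => /(_ isT).
rewrite addbA => hv hu; congr (_ (+) _).
move: uv; rewrite lattice_adjE /crosses; lia.
Qed.

(* The parity of the number of crossings of the vertical path [S'] by the
   leftward half-line from [z] does not change when [z] moves along a path
   which avoids [S']; it is even on the left side and odd on the right one. *)
Lemma crossing_paths_meet (a b c d : int) (S S' : set vertex) x y x' y' :
  (forall u, S u -> a <= u.1 <= b /\ c <= u.2 <= d) ->
  (forall u, S' u -> a <= u.1 <= b /\ c <= u.2 <= d) ->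
  conn S x y -> x.1 = a -> y.1 = b -> conn S' x' y' -> x'.2 = c -> y'.2 = d ->
  exists u, S u /\ S' u.
Proof.
move=> Sbox Sbox' xy xa yb xy' xc yd; apply: contrapT => disj.
(* The vertical path is extended by one vertex at each end, so that its ends leave the rows of the
   rectangle: the potential vanishes there, and the parity is odd on the right side. *)
pose p := (x'.1, x'.2 - 1); pose q := (y'.1, y'.2 + 1).
pose T := [set u | [\/ S' u, u = p | u = q]].
have Sx' := conn_start xy'; have Sy' := conn_end xy'.
have pq : conn T p q.
  apply: (@conn_trans _ _ x').
    by apply: conn_adj; [constructor 2|constructor 1|rewrite lattice_adjE /=; lia].
  apply: (@conn_trans _ _ y'); first by apply: conn_sub xy' => u; constructor 1.
  by apply: conn_adj; [constructor 1|constructor 3|rewrite lattice_adjE /=; lia].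
move: pq => /conn_pathP[s [ps sT lq]].
have Tx u : u \in p :: s -> a <= u.1 <= b.
  move=> /sT[/Sbox'[]//|->|->] /=.
    by have [] := Sbox' _ Sx'.
  by have [] := Sbox' _ Sy'.
have ST u : S u -> u \notin p :: s.
  move=> Su; apply/negP => /sT[Su'|up|uq]; first by apply: disj; exists u.
    by have [_] := Sbox _ Su; rewrite up /=; lia.
  by have [_] := Sbox _ Su; rewrite uq /=; lia.
have Sx := conn_start xy; have Sy := conn_end xy.
suff : crossing_parity x p s = crossing_parity y p s.
  rewrite (@crossing_parity_left x) ?ST//; last first.
    by move=> u /Tx; rewrite xa; lia.
  rewrite (@crossing_parity_right y)//; last by move=> u /Tx; rewrite yb; lia.
  rewrite lq /=; have [_] := Sbox _ Sy; lia.
elim: xy => // u v xu IH uv Sv; rewrite IH; have Su := conn_end xu.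
have := crossing_parity_adj uv ps (ST _ Su) (ST _ Sv).
have [[_ Hu] [_ Hv]] := (Sbox _ Su, Sbox _ Sv).
have -> : left_of_upper u v p = false.
  by rewrite /left_of_upper /=; case: ifP => ?; [|case: ifP => ?]; lia.
have -> : left_of_upper u v (last p s) = false.
  by rewrite lq /left_of_upper /=; case: ifP => ?; [|case: ifP => ?]; lia.
by case: crossing_parity; case: crossing_parity.
Qed.

End Crossing.

(** * Arm events, lattice symmetries and exploration of a cluster *)

Section Arms.
Context {R : realType}.
Implicit Types (A X Y S C : set vertex) (w : configuration) (D : seq vertex) (t : R).

Definition all_closed : configuration := fun=> false.

Definition is_symmetry (f g : vertex -> vertex) : Prop :=
  [/\ cancel f g, cancel g f,
      forall u v, lattice_adj u v -> lattice_adj (f u) (f v) &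
      forall u v, lattice_adj u v -> lattice_adj (g u) (g v)].

Lemma connects_symmetry f g A X Y w : is_symmetry f g ->
  connects A X Y (w \o g) <->
  connects (f @^-1` A) (f @^-1` X) (f @^-1` Y) w.
Proof.
move=> [fK gK fadj gadj]; split=> [[x [y [Xx Yy xy]]]|[x [y [Xx Yy xy]]]].
  exists (g x), (g y); split; rewrite /= ?gK//.
  by apply: conn_map xy => // u [Au wu]; split; rewrite /= ?gK.
exists (f x), (f y); split => //.
by apply: conn_map xy => // u [Au wu]; split; rewrite //= fK.
Qed.

Lemma prob_connects_symmetry f g A X Y D D' t w w' : is_symmetry f g ->
  uniq D -> uniq D' -> (forall u, A u -> u \in D) -> (forall u, A (f u) -> u \in D') ->
  prob (fun=> t) D (connects A X Y) w =
  prob (fun=> t) D' (connects (f @^-1` A) (f @^-1` X) (f @^-1` Y)) w'.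
Proof.
move=> fg uD uD' AD AD'; have [fK gK fadj gadj] := fg.
transitivity (prob (fun=> t) (map f D') (connects A X Y) (w' \o g)).
  apply: (@eq_expect_sites _ _ _ _ _ A) => //.
  - by rewrite map_inj_uniq//; exact: can_inj fK.
  - exact: depends_on_indic (@connects_dep _ _ _).
  - by move=> u Au; apply/mapP; exists (g u); rewrite ?gK//; apply: AD'; rewrite gK.
rewrite /prob (expect_map _ _ _ _ fK gK).
have -> : (w' \o g) \o f = w' by apply/funext => u /=; rewrite fK.
apply: eq_expect => v; rewrite !indicE; congr (_ %:R); congr nat_of_bool.
by apply/idP/idP; rewrite !in_setE; rewrite (connects_symmetry _ _ _ _ fg).
Qed.

Lemma translation_symmetry c : is_symmetry (vadd c) (fun u => vsub u c).
Proof.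
have vaddK : cancel (vadd c) (fun u => vsub u c).
  by case=> a b; rewrite /vadd /vsub /=; congr pair; lia.
have vsubK : cancel (fun u => vsub u c) (vadd c).
  by case=> a b; rewrite /vadd /vsub /=; congr pair; lia.
by split=> // u v; rewrite !lattice_adjE /vadd /vsub /=; lia.
Qed.

Definition shell c n : set vertex := [set v | norm (vsub v c) = n].

Lemma vsub0 u : vsub u origin = u.
Proof. by case: u => a b; rewrite /vsub /= !subr0. Qed.

Lemma vsubvv u : vsub u u = origin.
Proof. by rewrite /vsub !subrr. Qed.

Lemma vsub_vadd c u : vsub (vadd c u) c = u.
Proof. by have [] := translation_symmetry c. Qed.

Lemma vadd_vsub c u : vadd c (vsub u c) = u.
Proof. by have [] := translation_symmetry c. Qed.

Lemma box0E n : box origin n = [set v | (norm v <= n)%N].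
Proof. by apply/funext => v; rewrite /box /= vsub0. Qed.

Lemma shell0E n : shell origin n = sphere n.
Proof. by apply/funext => v; rewrite /shell /= vsub0. Qed.

Definition arm c N n : set configuration := connects (box c n) (box c N) (shell c n).

(* [arm_prob t 0 n] is [theta_n(t)]. *)
Definition arm_prob t N n : R := prob (fun=> t) (box_seq n) (arm origin N n) all_closed.

Lemma arm_prob_translate t c N n D w : uniq D -> (forall u, box c n u -> u \in D) ->
  prob (fun=> t) D (arm c N n) w = arm_prob t N n.
Proof.
move=> uD bD; rewrite /arm_prob /arm.
rewrite (@prob_connects_symmetry _ _ _ _ _ D (box_seq n) t w all_closed
  (translation_symmetry c))//; first last.
- by move=> u; rewrite /box mem_box_seq /= vsub_vadd.
- exact: box_seq_uniq.
have vadd_box m : vadd c @^-1` box c m = box origin m.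
  by apply/funext => u; rewrite /box /= vsub_vadd vsub0.
rewrite !vadd_box; congr (prob _ _ (connects _ _ _) _).
by apply/funext => u; rewrite /shell /= vsub_vadd vsub0.
Qed.

(** The walk is stopped at its first visit to the shell; the distance to [c] grows by at most one
    per step, so the shell cannot be jumped over. *)
Lemma conn_in_cut A w c n x z : conn_in A w x z ->
  (norm (vsub x c) <= n)%N -> (n <= norm (vsub z c))%N ->
  exists z', shell c n z' /\ conn_in (A `&` box c n) w x z'.
Proof.
move=> xz xn nz; have [Ax wx] := conn_start xz.
have [xE|xE] := eqVneq (norm (vsub x c)) n.
  by exists x; split=> //; apply: conn_refl; split; [split|].
have [||u [v [xu uv nv [Av wv]]]] := @conn_enter _ [set v | (n <= norm (vsub v c))%N] _ _ xz.
- by move=> /=; apply/negP; rewrite -ltnNge ltn_neqAle xE.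
- by [].
have /= := norm_sub_adj c uv; have [_ /= /negP] := conn_end xu.
rewrite -ltnNge => un vu; have vn : norm (vsub v c) = n by apply/eqP; rewrite eqn_leq nv (leq_trans vu).
exists v; split=> //; apply: conn_rcons uv _; last by split=> //; split=> //=; rewrite /box/= vn.
apply: conn_sub xu => s [[As ws] /= /negP]; rewrite -ltnNge => /ltnW sn.
by split=> //; split.
Qed.

Definition cluster_from S X w : set vertex :=
  [set u | exists2 x, X x & conn_in S w x u].

(** These are the sites whose states are revealed when the exploration from the seeds [X] in [S]
    ends with the cluster [C]. *)
Definition explored S X C : set vertex :=
  [set u | S u /\ [\/ X u, C u | exists2 v, C v & lattice_adj v u]].

Lemma explored_open S X w u : explored S X (cluster_from S X w) u -> w u ->
  cluster_from S X w u.
Proof.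
move=> [Su [Xu|//|[v [x Xx xv] vu]]] wu; first by exists u => //; exact: conn_refl.
by exists x => //; exact: conn_rcons xv vu _.
Qed.

(** Configurations agreeing on the explored sites give the same exploration: it meets the same open
    sites and the same closed outer boundary. *)
Lemma cluster_from_dep S X C :
  depends_on (explored S X C) (fun w => cluster_from S X w == C).
Proof.
suff H w w' : (forall u, explored S X C u -> w u = w' u) ->
    cluster_from S X w = C -> cluster_from S X w' = C.
  move=> w w' ww'; apply/eqP/eqP; first exact: H.
  by apply: H => u /ww' ->.
move=> ww' wC; apply/seteqP; split=> u.
  move=> [x Xx xu]; apply: (conn_invariant xu).
    have [Sx wx] := conn_start xu; rewrite -wC; exists x => //.
    by apply: conn_refl; split=> //=; rewrite ww'//; split=> //; constructor 1.
  move=> s v Cs sv [Sv wv].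
  have Ev : explored S X C v by split=> //; constructor 3; exists s.
  by rewrite -wC; apply: explored_open; rewrite ?wC ?ww'.
rewrite -{1}wC => -[x Xx xu]; exists x => //.
apply: conn_sub (conn_cluster xu) => s xs; have [Ss ws] := conn_end xs.
split=> //=; rewrite -ww'//; split=> //; constructor 2.
by rewrite -wC; exists x.
Qed.

Definition reach S y : set configuration :=
  connects S [set origin] [set u | lattice_adj u y].

(* This is [psi_t(S)] when [S] lies in the box of radius [n - 1], so that the outer
   boundary of [S] lies in the box of radius [n]. *)
Definition exit_mean t n S : R :=
  expect (fun=> t) (box_seq n)
    (fun w => \sum_(y <- box_seq n) (`[< ~ S y >])%:R * \1_(reach S y) w) all_closed.

Lemma is_prob_cst t : 0 <= t <= 1 -> is_prob (fun _ : vertex => t).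
Proof. by move=> t01 i. Qed.

Lemma reach_clusterP S w y :
  reach S y w <-> exists2 u, cluster_from S [set origin] w u & lattice_adj u y.
Proof.
split=> [[x [u [-> uy xu]]]|[u [x -> xu] uy]].
  by exists u => //; exists origin.
by exists origin, u.
Qed.

Lemma exit_mean_dep t n S D w : uniq D -> (forall u, S u -> (norm u < n)%N) ->
  (forall u, S u -> u \in D) ->
  expect (fun=> t) D
    (fun w => \sum_(y <- box_seq n) (`[< ~ S y >])%:R * \1_(reach S y) w) w =
  exit_mean t n S.
Proof.
move=> uD Sn SD; apply: (@eq_expect_sites _ _ _ _ _ S) => //.
- exact: box_seq_uniq.
- move=> v v' vv'; apply: eq_bigr => y _; congr (_ * _).
  exact: (depends_on_indic (@connects_dep S _ _)).
- by move=> u /Sn; rewrite mem_box_seq => /ltnW.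
Qed.

(** The arm is cut at its last exit from the cluster of the origin in [S]. It continues from a site
    [y] outside [S] through unexplored sites, whose law is unchanged, and this continuation contains
    an arm of length [n] from [y]. *)
Lemma arm_prob_submult t L S n : 0 <= t <= 1 -> S origin ->
  (forall u, S u -> (norm u < L)%N) ->
  arm_prob t 0 (n + L) <= exit_mean t L S * arm_prob t 0 n.
Proof.
move=> t01 S0 SL; have tP := is_prob_cst t01.
set D := box_seq (n + L).
have uD : uniq D by exact: box_seq_uniq.
have SD u : S u -> u \in D.
  by move=> /SL; rewrite mem_box_seq; lia.
pose K := cluster_from S [set origin].
pose A := explored S [set origin].
pose far C y := connects (box origin (n + L) `\` A C) [set y] (sphere (n + L)).
pose H C w := \sum_(y <- box_seq L)
  ((`[< ~ S y >])%:R * (`[< exists2 u, C u & lattice_adj u y >])%:R) * \1_(far C y) w : R.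
have HA C : depends_on (~` A C) (H C).
  move=> w w' ww'; apply: eq_bigr => y _; congr (_ * _).
  apply: (depends_on_indic (@connects_dep _ _ _)) => u [_ Au]; exact: ww'.
apply: (@le_trans _ _ (expect (fun=> t) D (fun w => H (K w) w) all_closed)).
  apply: le_expect => // w.
  have [armw|] := pselect (arm origin 0 (n + L) w); last first.
    move=> /indic0' ->; apply: sumr_ge0 => y _.
    by apply: mulr_ge0; [exact: mulr_ge0|exact: indic_ge0].
  rewrite indic1//; case: armw => x [z []].
  rewrite box0E shell0E => /= x0 zn xz.
  have {x0} ? : x = origin by case: x x0 {xz} => a b; rewrite /norm /origin /= => ?; congr pair; lia.
  subst x.
  have [_ w0] := conn_start xz.
  have K0 : K w origin by exists origin => //; apply: conn_refl.
  have Kz : ~ K w z by move=> [x _ /conn_end[/SL]]; rewrite zn; lia.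
  have [u [y [Ku _ uy yz]]] := conn_exit xz K0 Kz.
  have [[_ wy] Ky] := conn_start yz.
  have Sy : ~ S y.
    move=> Sy; apply: Ky; case: Ku => x -> xu.
    by exists origin => //; exact: conn_rcons xu uy _.
  have yL : y \in box_seq L.
    have /SL : S u by case: Ku => x _ /conn_end[].
    by rewrite mem_box_seq; have := norm_adj uy; lia.
  rewrite /H (bigD1_seq y) ?box_seq_uniq//=.
  have -> : `[< ~ S y >] by apply/asboolP.
  have -> : `[< exists2 u, K w u & lattice_adj u y >] by apply/asboolP; exists u.
  rewrite !mul1r indic1.
    rewrite lerDl; apply: sumr_ge0 => s _.
    by apply: mulr_ge0; [exact: mulr_ge0|exact: indic_ge0].
  exists y, z; split=> //; apply: conn_sub yz => s [[bs ws] Ks].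
  by split=> //; split=> // As; apply: Ks; exact: explored_open.
rewrite (@expect_explore _ _ _ _ _ K A)//; last exact: cluster_from_dep.
rewrite -(exit_mean_dep t all_closed uD SL SD) mulrC -expectZ.
apply: le_expect => // w.
rewrite expect_sum mulr_sumr big_seq [leRHS]big_seq; apply: ler_sum => y.
rewrite mem_box_seq => yL.
rewrite expectZ mulrC.
have -> : \1_(reach S y) w = (`[< exists2 u, K w u & lattice_adj u y >])%:R :> R.
  rewrite indicE; congr (_ %:R); congr nat_of_bool; apply/idP/idP.
    by rewrite in_setE => /reach_clusterP ?; apply/asboolP.
  by move=> /asboolP ?; rewrite in_setE; apply/reach_clusterP.
apply: ler_wpM2r; first exact: mulr_ge0.
pose D' := box_seq (n + L + L).
have -> : expect (fun=> t) D (\1_(far (K w) y)) all_closed =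
    expect (fun=> t) D' (\1_(far (K w) y)) all_closed.
  apply: (@eq_expect_sites _ _ _ _ _ (box origin (n + L))) => //.
  - exact: box_seq_uniq.
  - apply: depends_onS (depends_on_indic (@connects_dep _ _ _)).
    by move=> u [].
  - by move=> u; rewrite box0E mem_box_seq.
  - by move=> u; rewrite box0E mem_box_seq /=; lia.
rewrite -(arm_prob_translate t (c := y) 0 all_closed (D := D')) ?box_seq_uniq//; last first.
  by move=> u; rewrite /box mem_box_seq /norm /vsub /= in yL *; lia.
apply: (@le_prob _ _ (fun=> t) D' _ _ all_closed tP) => v [x [z [/= -> zn xz]]].
(* As [y] has norm at most [L], the sphere of radius [n + L] is at distance at least [n] from
   [y]. *)
have [||z' [z'n xz']] := @conn_in_cut _ _ y n _ _ xz.
- by rewrite vsubvv.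
- by have := zn; rewrite /sphere /norm /vsub /= in yL *; lia.
exists y, z'; split=> //; first by rewrite /box /= vsubvv.
by apply: conn_in_mono xz' => // u [].
Qed.

End Arms.

(** * Pivotal sites and the differential inequality for [theta_n] *)

Section Sharpness.
Context {R : realType}.
Implicit Types (S C : set vertex) (w : configuration) (t : R).

Lemma arm0P n w : arm origin 0 n w <->
  cluster_from (box origin n) (sphere n) w origin.
Proof.
rewrite /arm shell0E; split=> [[x [z [x0 zn xz]]]|[z zn zo]].
  have ? : x = origin.
    by case: x x0 {xz} => a b; rewrite box0E /norm /origin /= => ?; congr pair; lia.
  by subst x; exists z => //; exact: conn_sym.
by exists origin, z; split; [rewrite box0E|exact: zn|exact: conn_sym].
Qed.

Lemma exit_mean_le n S t t' : 0 <= t <= 1 -> 0 <= t' <= 1 -> t <= t' ->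
  exit_mean t n S <= exit_mean t' n S.
Proof.
move=> t01 t01' tt'; apply: (le_expect_weight _ _ (is_prob_cst t01) (is_prob_cst t01')) => //.
move=> w w' ww'; apply: ler_sum => y _; apply: ler_wpM2l => //.
by apply: indic_le; exact: connects_inc.
Qed.

(** An explored site is a seed, a member of the cluster or a neighbour of one, so opening it joins
    it to the sphere; this is what makes sites pivotal. *)
Lemma explored_to_seed n w y (K := cluster_from (box origin n) (sphere n)) :
  explored (box origin n) (sphere n) (K w) y ->
  exists2 x, sphere n x & conn_in (box origin n) (upd w y true) y x.
Proof.
move=> [by_ H].
have yy : (box origin n `&` [set u | upd w y true u]) y.
  by split; rewrite //= /upd eqxx.
have inc u v : conn_in (box origin n) w u v -> conn_in (box origin n) (upd w y true) u v.
  by apply: conn_in_mono => //; exact: config_le_upd_true.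
case: H => [ny|[x nx /inc xy]|[v [x nx /inc xv] vy]].
- by exists y => //; exact: conn_refl.
- by exists x => //; exact: conn_sym.
- by exists x => //; apply: conn_sym; exact: conn_rcons xv vy _.
Qed.

(* Given the cluster of the sphere, the sites not revealed form a set [S]; if it
   contains the origin, the closed pivotal sites are those counted by [exit_mean]
   for [S], and otherwise the origin itself is pivotal. *)
Lemma pivotal_lower_bound t n : 0 <= t <= 1 ->
  (forall S, S origin -> (forall u, S u -> (norm u < n)%N) -> 1 <= exit_mean t n S) ->
  1 - arm_prob t 0 n <= \sum_(i <- box_seq n) expect (fun=> t) (box_seq n)
    (fun w => \1_(arm origin 0 n) (upd w i true) - \1_(arm origin 0 n) (upd w i false))
    all_closed.
Proof.
move=> t01 Sge1; have tP := is_prob_cst t01.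
set D := box_seq n; pose B := box origin n.
have uD : uniq D by exact: box_seq_uniq.
have DE u : (u \in D) = (norm u <= n)%N by exact: mem_box_seq.
pose K := cluster_from B (sphere n).
pose A := explored B (sphere n).
pose S C := B `\` A C.
(* A lower bound for the number of pivotal sites given the cluster [C] of the sphere: none if the
   origin is in [C], the origin if it is explored but outside [C], and otherwise the exits from the
   unexplored set. *)
pose H C w : R := if `[< C origin >] then 0 else if `[< A C origin >] then 1 else
  \sum_(y <- D) (`[< ~ S C y >])%:R * \1_(reach (S C) y) w.
have HA C : depends_on (~` A C) (H C).
  move=> w w' ww'; rewrite /H; case: ifP => // _; case: ifP => // _.
  apply: eq_bigr => y _; congr (_ * _).
  by apply: (depends_on_indic (@connects_dep _ _ _)) => u [_ Au]; exact: ww'.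
have H0 C w : 0 <= H C w.
  rewrite /H; case: ifP => // _; case: ifP => // _; apply: sumr_ge0 => y _.
  by apply: mulr_ge0 => //; exact: indic_ge0.
apply: (@le_trans _ _ (expect (fun=> t) D
    (fun v => expect (fun=> t) D (H (K v)) all_closed) all_closed)).
  rewrite -prob_setC; apply: le_expect => // w.
  have [armw|armw] := pselect (arm origin 0 n w).
    by rewrite indic0' ?expect_ge0// => /(_ armw).
  rewrite indic1// /H.
  have -> : `[< K w origin >] = false by apply/asboolPn => /arm0P.
  case: asboolP => [_|Ao]; first by rewrite expect_cst.
  (* Sites of the sphere are seeds, hence explored, so the unexplored set has radius less than
     [n]. *)
  have SA u : S (K w) u -> (norm u < n)%N.
    rewrite /S /B box0E => -[/= un Au]; rewrite ltn_neqAle un andbT; apply/eqP => nu.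
    by apply: Au; split; [rewrite /B box0E|constructor 1].
  apply: (Sge1 (S (K w))); last exact: SA.
  by split; [rewrite /B box0E|exact: Ao].
rewrite -(@expect_explore _ _ _ _ _ K A)//; last exact: cluster_from_dep.
rewrite -expect_sum; apply: le_expect => // w.
have incarm : increasing_event (arm origin 0 n) by exact: connects_inc.
have dge0 i : 0 <= \1_(arm origin 0 n) (upd w i true) -
    \1_(arm origin 0 n) (upd w i false) :> R.
  by rewrite subr_ge0; apply: (increasing_indic incarm); exact: config_le_upd.
rewrite /H; case: asboolP => Ko; first by apply: sumr_ge0.
have armN i : \1_(arm origin 0 n) (upd w i false) = 0 :> R.
  by rewrite indic0'// => h; apply/Ko/arm0P; apply: incarm h; exact: config_le_upd_false.
case: asboolP => [Ao|Ao].
  rewrite (bigD1_seq origin) ?DE//= armN subr0 indic1.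
    by rewrite lerDl sumr_ge0.
  by apply/arm0P; have [x xn ox] := explored_to_seed Ao; exists x => //; exact: conn_sym.
rewrite big_seq [leRHS]big_seq; apply: ler_sum => y; rewrite DE => yn.
case: asboolP => Sy; last by rewrite mul0r.
have [ry|ry] := pselect (reach (S (K w)) y w); last by rewrite indic0'// mulr0.
rewrite mul1r armN subr0 [leLHS]indic1// indic1//.
have Ay : A (K w) y by apply: contrapT => Ay; apply: Sy; split=> //; rewrite /B box0E.
have [x xn yx] := explored_to_seed Ay.
case: ry => o [u [/= -> uy ou]]; apply/arm0P; exists x => //; apply: conn_sym.
have [By wy] := conn_start yx.
apply: conn_trans yx; apply: conn_rcons uy _ => //.
by apply: conn_in_mono ou; [move=> v []|exact: config_le_upd_true].
Qed.

(** Mean value theorem: at the intermediate density the derivative is at least [1 - theta_n],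
    because [exit_mean] increases with the density and so stays at least 1. *)
Lemma arm_prob_ge t t' n : 0 <= t -> t < t' -> t' <= 1 ->
  (forall S, S origin -> (forall u, S u -> (norm u < n)%N) -> 1 <= exit_mean t n S) ->
  (t' - t) * (1 - arm_prob t' 0 n) <= arm_prob t' 0 n.
Proof.
move=> t0 tt' t1 Sge1.
pose df s := \sum_(i <- box_seq n) expect (fun=> s) (box_seq n)
    (fun w => \1_(arm origin 0 n) (upd w i true) - \1_(arm origin 0 n) (upd w i false))
    all_closed : R.
have fdf (s : R) : is_derive s 1 (fun s => arm_prob s 0 n) (df s).
  by apply: is_derive_expect; exact: box_seq_uniq.
have [c ctt' E] : exists2 c, c \in `]t, t'[%R &
    arm_prob t' 0 n - arm_prob t 0 n = df c * (t' - t).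
  apply: (@MVT _ (fun s => arm_prob s 0 n)) => //.
  by apply: derivable_within_continuous => s _; exact: ex_derive.
move: ctt'; rewrite in_itv /= => /andP[tc ct'].
have mono s s' : 0 <= s <= 1 -> 0 <= s' <= 1 -> s <= s' -> arm_prob s 0 n <= arm_prob s' 0 n.
  move=> s01 s01' ss'; apply: (le_expect_weight _ _ (is_prob_cst s01) (is_prob_cst s01')) => //.
  by apply: increasing_indic; exact: connects_inc.
have : arm_prob c 0 n <= arm_prob t' 0 n by apply: mono; lra.
have : 1 - arm_prob c 0 n <= df c.
  apply: pivotal_lower_bound => [|S S0 Sn]; first lra.
  by apply: le_trans (Sge1 S S0 Sn) _; apply: exit_mean_le; lra.
have : 0 <= arm_prob t 0 n by apply: prob_ge0; apply: is_prob_cst; lra.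
move=> a0 h1 h2.
have : (t' - t) * (1 - arm_prob t' 0 n) <= (t' - t) * df c.
  by apply: ler_wpM2l; lra.
lra.
Qed.

End Sharpness.

(** * From a uniform lower bound on arms to probabilities close to 1 *)

Section ZeroOne.
Context {R : realType}.
Implicit Types (t : R).

Lemma arm_sub c d N n A X m : (forall u, X u -> box c N u) -> (N <= n)%N ->
  (forall u, shell d m u -> (n <= norm (vsub u c))%N) ->
  connects A X (shell d m) `<=` arm c N n.
Proof.
move=> XN Nn mn w [x [z [/XN xN /mn nz xz]]].
have [z' [z'n xz']] := conn_in_cut xz (leq_trans xN Nn) nz.
by exists x, z'; split=> //; apply: conn_in_mono xz' => // u [].
Qed.

(** Inclusion-exclusion for long arms from two boxes of radius [N]. Either arm starts in the large
    box containing both; if both occur, so do two arms of length [M] in disjoint boxes, which are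
    independent. *)
Lemma prob_arm_two t c N M n D w : 0 <= t <= 1 -> uniq D ->
  (N <= M)%N -> norm c = M.*2.+1 -> (N + (3 * M).+1 <= n)%N ->
  (forall u, (norm u <= n + (M.*2.+1).*2)%N -> u \in D) ->
  prob (fun=> t) D (arm origin N n) w + prob (fun=> t) D (arm c N (n + M.*2.+1)) w <=
  prob (fun=> t) D (arm origin (N + (3 * M).+1) n) w +
  prob (fun=> t) D (arm origin N M) w * prob (fun=> t) D (arm c N M) w.
Proof.
move=> t01 uD NM cM Nn DP; have tP := is_prob_cst t01.
have h2 : prob (fun=> t) D (arm c N (n + M.*2.+1)) w <=
    prob (fun=> t) D (connects setT (box c N) (shell origin n)) w.
  apply: le_prob => // v [x [z [xN zn xz]]].
  have [||z' [z'n xz']] := @conn_in_cut _ _ origin n _ _ xz.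
  - by move: xN cM; rewrite /box /norm /vsub /=; lia.
  - by move: zn cM; rewrite /shell /norm /vsub /=; lia.
  by exists x, z'; split=> //; apply: conn_in_mono xz' => // u [].
rewrite -(prob_indep _ _ _ (A := box origin M)); first last.
- apply: depends_onS (@connects_dep _ _ _) => u; move: cM.
  by rewrite /box /norm /vsub /= => ? ? ?; lia.
- exact: connects_dep.
apply: (@le_trans _ _ (prob (fun=> t) D (arm origin N n) w +
  prob (fun=> t) D (connects setT (box c N) (shell origin n)) w)).
  by rewrite lerD2l.
rewrite -prob_setU; apply: lerD; apply: le_prob => // v.
  move=> [[x [z [xN zn xz]]]|[x [z [xN zn xz]]]].
    by exists x, z; split=> //; move: xN; rewrite /box /=; lia.
  have [||z' [z'n xz']] := @conn_in_cut _ _ origin n _ _ xz.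
  - by move: xN cM; rewrite /box /norm /vsub /=; lia.
  - by rewrite zn.
  exists x, z'; split=> //; last by apply: conn_in_mono xz' => // u [].
  by move: xN cM; rewrite /box /norm /vsub /=; lia.
move=> [h1 h3]; split.
  apply: arm_sub h1 => // u; rewrite /shell /=; lia.
apply: arm_sub h3 => // u; move: cM; rewrite /shell /norm /vsub /=; lia.
Qed.

(** Let [a] be the supremum of the bounds valid for some [N] uniformly in [n]. Two distant boxes
    give [2 a - a ^ 2 <= a], and [a > 0] then forces [a = 1]. *)
Lemma arm_prob_to1 (t c0 : R) : 0 <= t <= 1 -> 0 < c0 ->
  (forall n, (0 < n)%N -> c0 <= arm_prob t 0 n) ->
  forall eps, 0 < eps -> exists N, forall n, (N <= n)%N -> 1 - eps <= arm_prob t N n.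
Proof.
move=> t01 c00 Hc; have tP := is_prob_cst t01.
pose E := [set x : R | exists2 N, (0 < N)%N & forall n, (N <= n)%N -> x <= arm_prob t N n].
have Ec0 : E c0.
  exists 1%N => // n n0; apply: le_trans (Hc n n0) _; apply: le_prob => //.
  apply: connectsS => // u; rewrite /box /=; lia.
have Ele1 : ubound E 1.
  by move=> x [N _ H]; apply: le_trans (H _ (leqnn N)) _; exact: prob_le1.
have supE : has_sup E by split; [exists c0|exists 1].
set a := sup E.
have a0 : 0 < a by apply: lt_le_trans c00 _; exact: (sup_upper_bound supE).
have a1 : a <= 1 by apply: sup_le_ub => //; exists c0.
have key eps : 0 < eps -> 2 * (a - eps) - (a + eps) ^+ 2 <= a.
  move=> eps0.
  have [x [N N0 Nx] ax] := sup_adherent eps0 supE; rewrite -/a in ax.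
  (* Otherwise [a + eps] would be a uniform lower bound exceeding the supremum. *)
  have [M NM Ma] : exists2 M, (N <= M)%N & arm_prob t N M <= a + eps.
    apply: contrapT => H.
    have : E (a + eps).
      exists N => // n Nn; rewrite leNgt; apply/negP => /ltW h.
      by apply: H; exists n.
    by move/(sup_upper_bound supE); rewrite -/a; lra.
  apply: (@le_trans _ _ (2 * x - (a + eps) ^+ 2)); first by lra.
  apply: (sup_upper_bound supE); exists (N + (3 * M).+1)%N => [|n Nn]; first lia.
  pose c : vertex := (M.*2.+1%:Z, 0).
  have cM : norm c = M.*2.+1 by rewrite /norm /=; lia.
  pose D := box_seq (n + (M.*2.+1).*2).
  have uD : uniq D by exact: box_seq_uniq.
  have DP u : (norm u <= n + (M.*2.+1).*2)%N -> u \in D by rewrite mem_box_seq.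
  have := prob_arm_two all_closed t01 uD NM cM Nn DP.
  have Mn : (M <= n)%N by clear - Nn; lia.
  have Mn' : (M <= n + M.*2.+1)%N by exact: leq_trans (leq_addr _ _).
  have origE k m : (m <= n)%N ->
      prob (fun=> t) D (arm origin k m) all_closed = arm_prob t k m.
    clear - DP uD => mn; apply: arm_prob_translate => // u.
    by rewrite box0E => /= um; apply: DP; apply: leq_trans um _; exact: leq_trans (leq_addr _ _).
  have cE k m : (m <= n + M.*2.+1)%N ->
      prob (fun=> t) D (arm c k m) all_closed = arm_prob t k m.
    clear - DP uD cM => mn; apply: arm_prob_translate => // u um; apply: DP.
    by clear - um mn cM; move: um cM; rewrite /box /norm /vsub /=; lia.
  rewrite !origE// !cE//.
  have Nn' : (N <= n)%N by exact: leq_trans (leq_addr _ _) Nn.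
  have := Nx _ Nn'; have := Nx _ (leq_trans Nn' (leq_addr M.*2.+1 n)) => h1 h2 h3.
  have : arm_prob t N M * arm_prob t N M <= (a + eps) * (a + eps).
    by apply: ler_pM => //; exact: prob_ge0.
  rewrite expr2; lra.
have {}a1 : a = 1.
  apply/eqP; rewrite eq_le a1 leNgt; apply/negP => lt1.
  (* The errors in [key] add up to [2 e + 2 a e + e ^ 2], at most [5 e], whereas [a - a ^ 2] equals
     [6 e]. *)
  have := key (a * (1 - a) / 6); rewrite divr_gt0 ?mulr_gt0 ?subr_gt0// => /(_ isT).
  set e := a * (1 - a) / 6.
  have e0 : 0 < e by rewrite divr_gt0 ?mulr_gt0 ?subr_gt0.
  have : e <= 1 by rewrite /e; nra.
  have : a * (1 - a) = 6 * e by rewrite /e; lra.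
  nra.
move=> eps eps0; have [x [N _ Nx] ax] := sup_adherent eps0 supE.
exists N => n /Nx; apply: le_trans; rewrite -a1; exact: ltW.
Qed.

End ZeroOne.

(** * Two open and two closed arms to the sides of a square *)

Section FourArms.
Context {R : realType}.
Implicit Types (t q : R) (c : vertex) (N n : nat) (w : configuration) (D : seq vertex).

Definition side_left c n : set vertex := [set v | v.1 - c.1 = - n%:Z].
Definition side_right c n : set vertex := [set v | v.1 - c.1 = n%:Z].
Definition side_bottom c n : set vertex := [set v | v.2 - c.2 = - n%:Z].
Definition side_top c n : set vertex := [set v | v.2 - c.2 = n%:Z].

Definition side_arm c N n (Y : set vertex) : set configuration :=
  connects (box c n) (box c N) Y.

Definition dual_config w : configuration := fun v => ~~ w v.

Definition four_arms c N n : set configuration :=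
  [set w | [/\ side_arm c N n (side_left c n) w, side_arm c N n (side_right c n) w,
     side_arm c N n (side_bottom c n) (dual_config w) &
     side_arm c N n (side_top c n) (dual_config w)]].

Lemma increasing_eventU (E E' : set configuration) :
  increasing_event E -> increasing_event E' -> increasing_event (E `|` E').
Proof.
by move=> incE incE' w w' ww' [/(incE _ _ ww')|/(incE' _ _ ww')]; [left|right].
Qed.

(** Square-root trick: the complements of increasing events are positively correlated as well. *)
Lemma harris_union (r : vertex -> R) D (E E' : set configuration) w : is_prob r ->
  increasing_event E -> increasing_event E' ->
  (1 - prob r D E w) * (1 - prob r D E' w) <= 1 - prob r D (E `|` E') w.
Proof.
move=> rP incE incE'; have := harris_prob D w rP incE incE'.
have := prob_setU r D E E' w; nra.
Qed.

(** In these coordinates the reflection of a single axis does not preserve adjacency; the central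
    inversion and the swap do, and together they act transitively on the four sides. *)
Definition vopp (v : vertex) : vertex := (- v.1, - v.2).
Definition vswap (v : vertex) : vertex := (v.2, v.1).

Lemma vopp_symmetry : is_symmetry vopp vopp.
Proof.
have voppK : cancel vopp vopp by case=> a b; rewrite /vopp /= !opprK.
by split=> // u v; rewrite !lattice_adjE /vopp /=; lia.
Qed.

Lemma vswap_symmetry : is_symmetry vswap vswap.
Proof. by split=> [[]|[]|u v|u v] //; rewrite !lattice_adjE /vswap /=; lia. Qed.

Lemma prob_side_symmetry f t N n Y : is_symmetry f f ->
  (forall v, norm (f v) = norm v) ->
  prob (fun=> t) (box_seq n) (side_arm origin N n Y) all_closed =
  prob (fun=> t) (box_seq n) (side_arm origin N n (f @^-1` Y)) all_closed.
Proof.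
move=> fP fn; have fbox m : f @^-1` box origin m = box origin m.
  by apply/funext => u; rewrite !box0E /= fn.
rewrite (@prob_connects_symmetry _ _ _ _ _ _ _ (box_seq n) t _ all_closed fP)//.
- by rewrite !fbox.
- exact: box_seq_uniq.
- exact: box_seq_uniq.
- by move=> u; rewrite box0E mem_box_seq.
- by move=> u; rewrite box0E mem_box_seq /= fn.
Qed.

Definition side_prob t N n : R :=
  prob (fun=> t) (box_seq n) (side_arm origin N n (side_left origin n)) all_closed.

Lemma prob_side_arm t c N n D w Y :
  Y \in [:: side_left; side_right; side_bottom; side_top] ->
  uniq D -> (forall u, box c n u -> u \in D) ->
  prob (fun=> t) D (side_arm c N n (Y c n)) w = side_prob t N n.
Proof.
move=> YE uD cD.
transitivity (prob (fun=> t) (box_seq n) (side_arm origin N n (Y origin n)) all_closed).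
  rewrite (@prob_connects_symmetry _ _ _ _ _ _ _ (box_seq n) t _ all_closed
    (translation_symmetry c))//; first last.
  - by move=> u; rewrite /box mem_box_seq /= vsub_vadd.
  - exact: box_seq_uniq.
  have vadd_box m : vadd c @^-1` box c m = box origin m.
    by apply/funext => u; rewrite /box /= vsub_vadd vsub0.
  rewrite !vadd_box; congr (prob _ _ (connects _ _ _) _).
  apply/funext => -[a b]; apply/propext.
  move: YE; rewrite !inE => /or4P[] /eqP -> /=;
    rewrite /side_left /side_right /side_bottom /side_top /vadd /=; lia.
have oppn v : norm (vopp v) = norm v by rewrite /norm /=; lia.
have swapn v : norm (vswap v) = norm v by rewrite /norm /vswap /= maxnC.
have topE : prob (fun=> t) (box_seq n) (side_arm origin N n (side_top origin n)) all_closed =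
    prob (fun=> t) (box_seq n) (side_arm origin N n (side_bottom origin n)) all_closed.
  rewrite (prob_side_symmetry _ _ _ _ vopp_symmetry oppn); congr (prob _ _ (connects _ _ _) _).
  by apply/funext => -[a b]; apply/propext; rewrite /side_top /side_bottom /=; lia.
have bottomE : prob (fun=> t) (box_seq n) (side_arm origin N n (side_bottom origin n)) all_closed =
    side_prob t N n.
  by rewrite (prob_side_symmetry _ _ _ _ vswap_symmetry swapn).
move: YE; rewrite !inE => /or4P[] /eqP -> //; last by rewrite topE.
rewrite (prob_side_symmetry _ _ _ _ vopp_symmetry oppn); congr (prob _ _ (connects _ _ _) _).
by apply/funext => -[a b]; apply/propext; rewrite /side_left /side_right /=; lia.
Qed.

(** An arm to the sphere ends on one of four sides; these are equally likely by symmetry, and their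
    failures are positively correlated. *)
Lemma arm_prob_side t N n : 0 <= t <= 1 ->
  (1 - side_prob t N n) ^+ 4 <= 1 - arm_prob t N n.
Proof.
move=> t01; have tP := is_prob_cst t01.
pose E Y := side_arm origin N n (Y origin n).
have incE Y : increasing_event (E Y) by exact: connects_inc.
have PE Y : Y \in [:: side_left; side_right; side_bottom; side_top] ->
    prob (fun=> t) (box_seq n) (E Y) all_closed = side_prob t N n.
  move=> YE; apply: prob_side_arm YE (box_seq_uniq n) _ => u.
  by rewrite box0E mem_box_seq.
apply: (@le_trans _ _ (1 - prob (fun=> t) (box_seq n)
  ((E side_left `|` E side_right) `|` (E side_bottom `|` E side_top)) all_closed)); last first.
  rewrite lerD2l lerN2; apply: le_prob => // w [x [z [xN zn xz]]].
  have : [\/ side_left origin n z, side_right origin n z, side_bottom origin n z |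
      side_top origin n z].
    move: zn; rewrite shell0E /side_left /side_right /side_bottom /side_top /sphere /norm /=.
    case: z {xz} => a b /= zn.
    have /or4P[/eqP|/eqP|/eqP|/eqP] :
        [|| a - 0 == - n%:Z, a - 0 == n%:Z, b - 0 == - n%:Z | b - 0 == n%:Z] by lia.
    + by constructor 1.
    + by constructor 2.
    + by constructor 3.
    + by constructor 4.
  by move=> [] zY; [left; left|left; right|right; left|right; right]; exists x, z.
have h1 := harris_union (box_seq n) all_closed tP (incE side_left) (incE side_right).
have h2 := harris_union (box_seq n) all_closed tP (incE side_bottom) (incE side_top).
have := harris_union (box_seq n) all_closed tP
  (increasing_eventU (incE side_left) (incE side_right))
  (increasing_eventU (incE side_bottom) (incE side_top)).
apply: le_trans; move: h1 h2; rewrite !PE ?inE ?eqxx ?orbT// => h1 h2.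
have -> : (1 - side_prob t N n) ^+ 4 = (1 - side_prob t N n) * (1 - side_prob t N n) *
  ((1 - side_prob t N n) * (1 - side_prob t N n)) by ring.
have sq0 : 0 <= (1 - side_prob t N n) * (1 - side_prob t N n) by rewrite -expr2 sqr_ge0.
exact: ler_pM.
Qed.

(** The bound [(8^-1) ^+ 4] makes each side arm fail with probability at most 1/8. Open arms are
    increasing and closed ones decreasing, so the four are combined by a union bound, which leaves
    1/2. *)
Lemma prob_four_arms q c N n (r : vertex -> R) D w :
  0 <= q <= 1 -> 1 - arm_prob q N n <= (8^-1) ^+ 4 ->
  (forall v, q <= r v <= 1 - q) -> uniq D -> (forall u, box c n u -> u \in D) ->
  1 / 2 <= prob r D (four_arms c N n) w.
Proof.
move=> q01 qN rq uD cD; have qP := is_prob_cst q01.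
have sq : 7 / 8 <= side_prob q N n.
  have : (1 - side_prob q N n) ^+ 4 <= (8^-1) ^+ 4.
    exact: le_trans (arm_prob_side _ _ q01) qN.
  rewrite ler_pXn2r ?nnegrE ?invr_ge0//; first lra.
  by rewrite subr_ge0 prob_le1.
have rP : is_prob r by move=> v; have := rq v; lra.
have rP' : is_prob (fun v => 1 - r v) by move=> v; have := rq v; lra.
have openP Y : Y \in [:: side_left; side_right; side_bottom; side_top] ->
    7 / 8 <= prob r D (side_arm c N n (Y c n)) w.
  move=> YE; apply: le_trans sq _; rewrite -(prob_side_arm q N w YE uD cD).
  apply: le_expect_weight => //; first by move=> v; have := rq v; lra.
  by apply: increasing_indic; exact: connects_inc.
have closedP Y : Y \in [:: side_left; side_right; side_bottom; side_top] ->
    7 / 8 <= expect r D (fun v => \1_(side_arm c N n (Y c n)) (dual_config v)) w.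
  move=> YE; apply: le_trans sq _; rewrite -(prob_side_arm q N (dual_config w) YE uD cD).
  rewrite expect_negb.
  under eq_expect => v.
    have -> : dual_config (fun u => ~~ v u) = v.
      by apply/funext => u; rewrite /dual_config negbK.
    over.
  apply: le_expect_weight => //; first by move=> v; have := rq v; lra.
  by apply: increasing_indic; exact: connects_inc.
have hL := openP side_left; have hR := openP side_right.
have hB := closedP side_bottom; have hT := closedP side_top.
move: hL hR hB hT; rewrite !inE !eqxx ?orbT => /(_ isT) hL /(_ isT) hR /(_ isT) hB /(_ isT) hT.
apply: (@le_trans _ _ (expect r D (fun v =>
  (\1_(side_arm c N n (side_left c n)) v + \1_(side_arm c N n (side_right c n)) v) +
  (\1_(side_arm c N n (side_bottom c n)) (dual_config v) +
   \1_(side_arm c N n (side_top c n)) (dual_config v)) - 3) w)).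
  rewrite expectB expect_cst !expectD; rewrite /prob in hL hR.
  move: hL hR hB hT; lra.
apply: le_expect => // v.
have [Q|Q] := pselect (four_arms c N n v).
  by rewrite [leRHS]indic1.
rewrite [leRHS]indic0'// !indicE.
case: (asboolP (side_arm c N n (side_left c n) v)) => [h1|h1]; last first.
  rewrite (memNset h1).
  by case: (_ \in _); case: (_ \in _); case: (_ \in _) => /=; lra.
case: (asboolP (side_arm c N n (side_right c n) v)) => [h2|h2]; last first.
  rewrite (memNset h2).
  by case: (_ \in _); case: (_ \in _); case: (_ \in _) => /=; lra.
case: (asboolP (side_arm c N n (side_bottom c n) (dual_config v))) => [h3|h3]; last first.
  rewrite (memNset h3).
  by case: (_ \in _); case: (_ \in _); case: (_ \in _) => /=; lra.
rewrite (@memNset _ (side_arm c N n (side_top c n))); last by move=> h4; apply: Q; split.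
by case: (_ \in _); case: (_ \in _); case: (_ \in _) => /=; lra.
Qed.

End FourArms.

(** * Opening a block merges clusters touching the boundary *)

Section BlockFlip.
Context {R : realType}.
Implicit Types (c : vertex) (N n M : nat) (w : configuration).

Lemma conn_box N u v : box origin N u -> box origin N v -> conn (box origin N) u v.
Proof.
suff H u' : box origin N u' -> conn (box origin N) origin u'.
  by move=> /H uo /H; apply: conn_trans; exact: conn_sym.
have [k] := ubnP (`|u'.1| + `|u'.2|)%N; elim: k u' => // k IH [a b] abk abN.
have step a' b' : (`|a'| + `|b'| < `|a| + `|b|)%N -> (norm (a', b') <= norm (a, b))%N ->
    lattice_adj (a', b') (a, b) -> conn (box origin N) origin (a, b).
  move=> lt le adj.
  have abN'' : box origin N (a', b') by move: abN; rewrite !box0E /=; exact: leq_trans.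
  apply: (conn_rcons _ adj abN); apply: IH abN'' => //=.
  by move: abk lt => /=; lia.
move: step {IH abk}; rewrite /norm /= => step.
have [a0|a0|a0] := ltgtP a 0.
- by apply: (step (a + 1) b); rewrite ?lattice_adjE /=; lia.
- by apply: (step (a - 1) b); rewrite ?lattice_adjE /=; lia.
have [b0|b0|b0] := ltgtP b 0.
- by apply: (step a (b + 1)); rewrite ?lattice_adjE /=; lia.
- by apply: (step a (b - 1)); rewrite ?lattice_adjE /=; lia.
by subst a b; exact: conn_refl.
Qed.

Definition block c N : seq vertex := map (vadd c) (box_seq N).

Lemma mem_block c N u : (u \in block c N) = (norm (vsub u c) <= N)%N.
Proof.
apply/mapP/idP => [[v]|uN]; first by rewrite mem_box_seq => vN ->; rewrite vsub_vadd.
by exists (vsub u c); rewrite ?mem_box_seq ?vadd_vsub.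
Qed.

Lemma block_uniq c N : uniq (block c N).
Proof.
have [vaddK _ _ _] := translation_symmetry c.
by rewrite map_inj_uniq ?box_seq_uniq//; exact: can_inj vaddK.
Qed.

Lemma conn_block c N u v : box c N u -> box c N v -> conn (box c N) u v.
Proof.
have [_ _ adjP _] := translation_symmetry c.
move=> un vn; rewrite -(vadd_vsub c u) -(vadd_vsub c v).
apply: conn_map adjP _ (@conn_box N _ _ _ _); rewrite ?box0E// => s.
by rewrite /box /= vsub_vadd.
Qed.

Definition boundary_seq M : seq vertex := [seq v <- box_seq M | norm v == M].

Lemma size_boundary_seq M : (size (boundary_seq M) <= 8 * M + 4)%N.
Proof.
pose s := [seq (k%:Z - M%:Z) | k <- iota 0 M.*2.+1].
pose L := [seq (M%:Z, b) | b <- s] ++ [seq (- M%:Z, b) | b <- s] ++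
  [seq (a, M%:Z) | a <- s] ++ [seq (a, - M%:Z) | a <- s].
have -> : (8 * M + 4 = size L)%N by rewrite !size_cat !size_map size_iota; lia.
apply: uniq_leq_size; first by rewrite filter_uniq ?box_seq_uniq.
have sE (a : int) : (`|a| <= M)%N -> a \in s.
  by move=> aM; apply/mapP; exists `|(a + M%:Z)%R|%N; rewrite ?mem_iota; lia.
case=> a b; rewrite mem_filter mem_box_seq /norm /= => /andP[nM _].
have aM : (`|a| <= M)%N by lia.
have bM : (`|b| <= M)%N by lia.
rewrite !mem_cat.
have /or4P[] : [|| a == M%:Z, a == - M%:Z, b == M%:Z | b == - M%:Z] by lia.
- by move=> /eqP ->; rewrite map_f ?sE.
- by move=> /eqP ->; rewrite [X in _ || (X || _)]map_f ?sE ?orbT.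
- by move=> /eqP ->; rewrite [X in _ || (_ || (X || _))](map_f (fun a => (a, M%:Z))) ?sE ?orbT.
- by move=> /eqP ->; rewrite [X in _ || (_ || (_ || X))](map_f (fun a => (a, - M%:Z))) ?sE ?orbT.
Qed.

(* The boundary sites not joined to an earlier one: one for each open cluster
   of the box touching its boundary, plus the closed boundary sites.  Counting
   the latter too makes the number of leaders decreasing in the configuration. *)
Definition leader M x : set configuration :=
  [set w | ~ exists2 y, (y \in boundary_seq M) &&
     (index y (boundary_seq M) < index x (boundary_seq M))%N &
     conn_in (box origin M) w x y].

Definition leaders M w : R := \sum_(x <- boundary_seq M) \1_(leader M x) w.

Lemma leader_dec M x w w' : config_le w w' -> leader M x w' -> leader M x w.
Proof.
move=> ww' Lw' [y ys xy]; apply: Lw'; exists y => //.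
exact: conn_in_mono xy.
Qed.

Lemma indic_leader_le M x w w' : config_le w w' ->
  \1_(leader M x) w' <= \1_(leader M x) w :> R.
Proof.
move=> ww'; have [h|h] := pselect (leader M x w').
  by rewrite !indic1//; exact: leader_dec h.
by rewrite [leLHS]indic0'// indic_ge0.
Qed.

Lemma leaders_dec M : decreasing_rv (leaders M).
Proof. by move=> w w' ww'; apply: ler_sum => x _; exact: indic_leader_le. Qed.

Lemma leaders_ge0 M w : 0 <= leaders M w.
Proof. by apply: sumr_ge0 => x _; exact: indic_ge0. Qed.

Lemma leaders_le M w : leaders M w <= (size (boundary_seq M))%:R.
Proof.
rewrite -sum1_size natr_sum; apply: ler_sum => x _; exact: indic_le1.
Qed.

(** The leader is the first boundary site of the cluster of [x]; the hypothesis on [x] and [x] says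
    that [x] is open. *)
Lemma earliest_connected M w x : x \in boundary_seq M -> conn_in (box origin M) w x x ->
  exists y, [/\ y \in boundary_seq M, conn_in (box origin M) w x y & leader M y w].
Proof.
move=> xs xx; set s := boundary_seq M in xs *.
have exP : exists i, has (fun y => (index y s == i) && `[< conn_in (box origin M) w x y >]) s.
  by exists (index x s); apply/hasP; exists x => //; rewrite eqxx; apply/asboolP.
case: (ex_minnP exP) => i /hasP[y ys /andP[/eqP yi /asboolP xy]] mini.
exists y; split=> // -[z /andP[zs zy] yz].
have : (i <= index z s)%N.
  apply: mini; apply/hasP; exists z => //; rewrite eqxx; apply/asboolP.
  exact: conn_trans yz.
by rewrite -yi leqNgt zy.
Qed.

(** When two clusters merge, the later of their two leaders is lost, while no site becomes a
    leader. *)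
Lemma leaders_drop M w w' x y : config_le w w' ->
  x \in boundary_seq M -> y \in boundary_seq M ->
  conn_in (box origin M) w x x -> conn_in (box origin M) w y y ->
  conn_in (box origin M) w' x y -> ~ conn_in (box origin M) w x y ->
  1 <= leaders M w - leaders M w'.
Proof.
move=> ww' xs ys xx yy xy' xy.
have [x0 [x0s xx0 Lx]] := earliest_connected xs xx.
have [y0 [y0s yy0 Ly]] := earliest_connected ys yy.
have inc u v : conn_in (box origin M) w u v -> conn_in (box origin M) w' u v.
  exact: conn_in_mono.
have x0y0 : conn_in (box origin M) w' x0 y0.
  by apply: (conn_trans (conn_sym (inc _ _ xx0))); apply: conn_trans xy' (inc _ _ yy0).
have x0Ny0 : x0 != y0.
  by apply/eqP => E; apply: xy; apply: conn_trans xx0 _; rewrite E; exact: conn_sym.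
have [z [zs Lz Lz']] : exists z, [/\ z \in boundary_seq M, leader M z w & ~ leader M z w'].
  have [lt|lt|E] := ltngtP (index x0 (boundary_seq M)) (index y0 (boundary_seq M)).
  - exists y0; split=> //; apply; exists x0; rewrite ?x0s//; exact: conn_sym.
  - by exists x0; split=> //; apply; exists y0; rewrite ?y0s.
  - by move/eqP: x0Ny0; case; exact: (index_inj origin x0s y0s E).
rewrite /leaders -sumrB (bigD1_seq z) ?filter_uniq ?box_seq_uniq//=.
rewrite (indic1 Lz) (indic0' Lz') subr0 lerDl; apply: sumr_ge0 => u _.
by rewrite subr_ge0; exact: indic_leader_le.
Qed.

(** After its last exit from the inner box, the arm does not feel a change of states inside that
    box. *)
Lemma side_arm_exit c N n (Y : set vertex) w : (forall u, box c N u -> ~ Y u) ->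
  side_arm c N n Y w -> exists u v z, [/\ box c N u, lattice_adj u v, Y z &
    conn_in (box c n `\` box c N) w v z].
Proof.
move=> NY [x [z [xN zY xz]]].
have zN : ~ box c N z by move=> /NY.
have [u [v [uN _ uv vz]]] := conn_exit xz xN zN.
exists u, v, z; split=> //; apply: conn_sub vz => s [[? ?] ?].
by split.
Qed.

Lemma set_block_out c N b w u : ~ box c N u -> set_block (block c N) b w u = w u.
Proof. by rewrite /set_block mem_block /box /=; case: ifP. Qed.

Lemma conn_in_set_block c N n b w u v : conn_in (box c n `\` box c N) w u v ->
  conn_in (box c n) (set_block (block c N) b w) u v.
Proof.
by apply: conn_sub => s [[sn sN] ws]; split=> //=; rewrite set_block_out.
Qed.

Lemma conn_box_set_block (S : set vertex) c N w u v :
  box c N `<=` S -> box c N u -> box c N v ->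
  conn_in S (set_block (block c N) true w) u v.
Proof.
move=> NS uN vN; apply: conn_sub (conn_block uN vN) => s sN; split; first exact: NS.
by rewrite /= /set_block mem_block sN.
Qed.

(* With the block closed, the bottom and top arms form a closed vertical
   crossing separating the left and right arms, which opening the block joins. *)
Lemma four_arms_drop c N M w : (norm c + N < M)%N -> four_arms c N M.*2 w ->
  1 <= leaders M (set_block (block c N) false w) -
       leaders M (set_block (block c N) true w).
Proof.
move=> cNM [].
set n := M.*2; set w0 := set_block _ false w; set w1 := set_block _ true w.
have nN : (N < n)%N by rewrite /n; lia.
move=> /side_arm_exit[|uL [vL [zL [uLN uvL zLY vzL]]]].
  by move=> u; rewrite /box /side_left /norm /vsub /=; lia.
move=> /side_arm_exit[|uR [vR [zR [uRN uvR zRY vzR]]]].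
  by move=> u; rewrite /box /side_right /norm /vsub /=; lia.
move=> /side_arm_exit[|uB [vB [zB [uBN uvB zBY vzB]]]].
  by move=> u; rewrite /box /side_bottom /norm /vsub /=; lia.
move=> /side_arm_exit[|uT [vT [zT [uTN uvT zTY vzT]]]].
  by move=> u; rewrite /box /side_top /norm /vsub /=; lia.
have boxM u : box c N u -> (norm u < M)%N.
  by move: cNM; rewrite /box /norm /vsub /=; lia.
have boxn u : box origin M u -> box c n u.
  by rewrite box0E; move: cNM; rewrite /n /box /norm /vsub /=; lia.
have w01 : config_le w0 w1.
  by move=> u; rewrite /w0 /w1 /set_block; case: ifP.
(* After leaving the block, an open arm is stopped at the boundary of the box of radius [M]; this
   yields the boundary site whose cluster will be merged. *)
have cut u v z : box c N u -> lattice_adj u v -> (M <= norm z)%N ->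
    conn_in (box c n `\` box c N) w v z ->
    exists x, [/\ x \in boundary_seq M, conn_in (box origin M) w0 v x &
      conn_in (box c n) w0 z x].
  move=> /boxM uM /norm_adj uv zM vz.
  have [||x [xM vx]] := @conn_in_cut _ _ origin M _ _ vz.
  - by rewrite vsub0; apply: leq_trans uv _.
  - by rewrite vsub0.
  exists x; split.
  - by rewrite mem_filter mem_box_seq; move: xM; rewrite shell0E => /= ->; rewrite eqxx leqnn.
  - apply: conn_sub vx => s [[[_ sN] sM] ws]; split=> //=.
    by rewrite /w0 set_block_out.
  - apply: (@conn_trans _ _ v); first by apply: conn_sym; exact: conn_in_set_block.
    apply: conn_sub vx => s [[[sn sN] sM] ws]; split=> //=.
    by rewrite /w0 set_block_out.
have zLM : (M <= norm zL)%N.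
  by move: zLY cNM; rewrite /side_left /n /norm /=; lia.
have zRM : (M <= norm zR)%N.
  by move: zRY cNM; rewrite /side_right /n /norm /=; lia.
have [xL [xLM vxL zxL]] := cut _ _ _ uLN uvL zLM vzL.
have [xR [xRM vxR zxR]] := cut _ _ _ uRN uvR zRM vzR.
have inc u v : conn_in (box origin M) w0 u v -> conn_in (box origin M) w1 u v.
  exact: conn_in_mono.
have self u v : conn_in (box origin M) w0 u v -> conn_in (box origin M) w0 v v.
  by move=> /conn_end; exact: conn_refl.
apply: (@leaders_drop _ _ _ xL xR) => //; [exact: self vxL|exact: self vxR| |].
  have step u v x : box c N u -> lattice_adj u v ->
      conn_in (box origin M) w0 v x -> conn_in (box origin M) w1 u x.
    move=> uN uv /inc vx; have Sv := conn_start vx; apply: conn_trans vx.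
    apply: conn_adj uv => //; split; first by rewrite box0E; exact/ltnW/boxM.
    by rewrite /= /w1 /set_block mem_block uN.
  apply: (conn_trans (conn_sym (step _ _ _ uLN uvL vxL))).
  apply: conn_trans (step _ _ _ uRN uvR vxR).
  apply: conn_box_set_block => // s /boxM; rewrite box0E; exact: ltnW.
(* A connection with the block closed would complete an open horizontal crossing of [box c n], to be
   compared with the closed vertical one. *)
move=> xLR.
have openLR : conn_in (box c n) w0 zL zR.
  apply: (conn_trans zxL); apply: conn_trans (conn_sym zxR).
  by apply: conn_sub xLR => s [/boxn ? ?].
pose v0 := dual_config w0.
have v0E : v0 = set_block (block c N) true (dual_config w).
  by apply/funext => u; rewrite /v0 /w0 /dual_config /set_block; case: ifP.
have closedBT : conn_in (box c n) v0 zB zT.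
  have step u v z : box c N u -> lattice_adj u v ->
      conn_in (box c n `\` box c N) (dual_config w) v z -> conn_in (box c n) v0 u z.
    move=> uN uv vz; rewrite v0E.
    have {}vz := conn_in_set_block true vz.
    have Sv := conn_start vz; apply: conn_trans vz.
    apply: conn_adj uv => //; split; last by rewrite /= /set_block mem_block uN.
    by rewrite /box /=; apply: leq_trans uN _; exact: ltnW.
  apply: (conn_trans (conn_sym (step _ _ _ uBN uvB vzB))).
  apply: conn_trans (step _ _ _ uTN uvT vzT); rewrite v0E.
  apply: conn_box_set_block => // s; rewrite /box /= => sN.
  by apply: leq_trans sN _; exact: ltnW.
have bnd (v : configuration) u : (box c n `&` [set u | v u]) u ->
    c.1 - n%:Z <= u.1 <= c.1 + n%:Z /\ c.2 - n%:Z <= u.2 <= c.2 + n%:Z.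
  by move=> [+ _]; rewrite /box /norm /vsub /=; lia.
have [||||u [[_ ou] [_ cu]]] :=
  crossing_paths_meet (bnd w0) (bnd v0) openLR _ _ closedBT.
- by move: zLY; rewrite /side_left /=; lia.
- by move: zRY; rewrite /side_right /=; lia.
- by move: zBY; rewrite /side_bottom /=; lia.
- by move: zTY; rewrite /side_top /=; lia.
by move: cu; rewrite /= /v0 /dual_config ou.
Qed.

End BlockFlip.

(** * Raising the density block by block *)

Section Contradiction.
Context {R : realType}.
Implicit Types (q : R) (c : vertex) (N M : nat) (cs : seq vertex).

Definition block_weight q N cs : vertex -> R :=
  fun u => if has (fun c => u \in block c N) cs then 1 / 2 else q.

Lemma block_weight_bounds q N cs u : 0 <= q -> q <= 1 / 2 ->
  q <= block_weight q N cs u <= 1 - q.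
Proof. by move=> q0 q1; rewrite /block_weight; case: ifP => _; lra. Qed.

(** Given the states outside the block, the coupling costs a factor [(1 / 2 - q) ^ |B|] times the
    drop from closed to open block; this drop is at least 1 on the four-arm event, of probability at
    least 1/2. *)
Lemma block_step q N M c cs w : 0 <= q -> q <= 1 / 2 -> (norm c + N < M)%N ->
  1 - arm_prob q N M.*2 <= (8^-1) ^+ 4 ->
  (forall c' u, c' \in cs -> u \in block c N -> u \notin block c' N) ->
  (1 / 2 - q) ^+ size (box_seq N) / 2 <=
  expect (block_weight q N cs) (box_seq (4 * M)) (leaders M) w -
  expect (block_weight q N (c :: cs)) (box_seq (4 * M)) (leaders M) w.
Proof.
move=> q0 q1 cNM qN disj; set r := block_weight q N cs; set r' := block_weight _ _ (c :: _).
have rP : is_prob r by move=> u; have := block_weight_bounds N cs u q0 q1; rewrite -/r; lra.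
have rP' : is_prob r'.
  by move=> u; have := block_weight_bounds N (c :: cs) u q0 q1; rewrite -/r'; lra.
set D := box_seq (4 * M); set B := block c N.
pose D' := [seq u <- D | u \notin B].
have uD : uniq D by exact: box_seq_uniq.
have DD' : perm_eq D (D' ++ B).
  apply: uniq_perm => //.
    rewrite cat_uniq filter_uniq// (block_uniq c N : uniq B) andbT.
    by apply/hasPn => u uB; rewrite mem_filter uB.
  move=> u; rewrite mem_cat mem_filter; case: (boolP (u \in B)) => //= uB.
    by rewrite mem_box_seq; move: uB cNM; rewrite mem_block /norm /vsub /=; lia.
  by rewrite orbF.
have splitE (s : vertex -> R) F : expect s D F w = expect s D' (expect s B F) w.
  by rewrite (expect_perm s F w uD DD') expect_cat.
have rr' u : u \notin B -> r' u = r u by rewrite /r' /r /block_weight /= => /negbTE ->.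
have -> : expect r' D (leaders M) w = expect r D' (expect r' B (leaders M)) w.
  rewrite splitE; apply: eq_expect_weight => u; rewrite mem_filter => /andP[uB _].
  exact: rr'.
rewrite (splitE r) -expectB.
pose G w := leaders M (set_block B false w) - leaders M (set_block B true w) : R.
apply: (@le_trans _ _ ((1 / 2 - q) ^+ size B * expect r D' G w)); last first.
  rewrite -expectZ; apply: le_expect => // v; apply: (@expect_block_drop _ _ q (1 / 2)) => //.
  - lra.
  - exact: block_uniq.
  - move=> u uB; rewrite /r /block_weight; case: hasP => // -[c' c's uc'].
    by have := disj _ _ c's uB; rewrite uc'.
  - by move=> u uB; rewrite /r' /block_weight /= uB.
  - move=> u; rewrite /r /r' /block_weight /=; case: (u \in block c N) => //=.
    by case: ifP => _; lra.
  - exact: leaders_dec.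
rewrite size_map; apply: ler_wpM2l; first by apply: exprn_ge0; lra.
rewrite -div1r.
(* The drop [G] overwrites the states of the block, so it may be averaged over the whole box. *)
have Gdep : depends_on (~` [set` B]) G.
  move=> v v' vv'; congr (leaders M _ - leaders M _); apply/funext => u;
    by rewrite /set_block; case: ifPn => // uB; apply: vv'; exact/negP.
have -> : expect r D' G w = expect r D G w.
  rewrite splitE; apply: eq_expect => v; rewrite (expect_filter _ _ _ Gdep).
  have -> : [seq u <- B | u \in ~` [set` B]] = [::]; last by [].
  apply/eqP; rewrite -(negbK (_ == _)) -has_filter -all_predC; apply/allP => u uB /=.
  by rewrite in_setC negbK inE.
have cD u : box c M.*2 u -> u \in D.
  by rewrite mem_box_seq; move: cNM; rewrite /box /norm /vsub /=; lia.
have q01 : 0 <= q <= 1 by lra.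
apply: le_trans (prob_four_arms w q01 qN (fun u => block_weight_bounds N cs u q0 q1) uD cD) _.
apply: le_expect => // v.
have [Q|Q] := pselect (four_arms c N M.*2 v).
  by rewrite indic1//; exact: four_arms_drop.
rewrite indic0'// subr_ge0; apply: leaders_dec => u.
by rewrite /set_block; case: ifP.
Qed.

(** The drops telescope: the blocks are disjoint, so each still has density [q] when its turn
    comes. *)
Lemma block_steps q N M cs w : 0 <= q -> q <= 1 / 2 -> uniq cs ->
  1 - arm_prob q N M.*2 <= (8^-1) ^+ 4 ->
  (forall c, c \in cs -> (norm c + N < M)%N) ->
  (forall c c' u, c \in cs -> c' \in cs -> u \in block c N -> u \in block c' N -> c = c') ->
  (size cs)%:R * ((1 / 2 - q) ^+ size (box_seq N) / 2) <=
  expect (fun=> q) (box_seq (4 * M)) (leaders M) w -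
  expect (block_weight q N cs) (box_seq (4 * M)) (leaders M) w.
Proof.
move=> q0 q1 + qN; elim: cs => [|c cs IH]; first by rewrite mul0r subrr.
rewrite cons_uniq => /andP[ccs ucs] Mcs disj.
have h1 : (norm c + N < M)%N by apply: Mcs; rewrite mem_head.
have h2 c' u : c' \in cs -> u \in block c N -> u \notin block c' N.
  move=> c's uc; apply/negP => uc'.
  have E : c = c' by apply: (disj c c' u); rewrite ?mem_head ?in_cons ?c's ?orbT.
  by rewrite E c's in ccs.
have := block_step w q0 q1 h1 qN h2.
have h3 c' : c' \in cs -> (norm c' + N < M)%N.
  by move=> c's; apply: Mcs; rewrite in_cons c's orbT.
have h4 c' c'' u : c' \in cs -> c'' \in cs -> u \in block c' N -> u \in block c'' N -> c' = c''.
  by move=> c's c''s; apply: disj; rewrite in_cons ?c's ?c''s orbT.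
have := IH ucs h3 h4.
have -> : (size (c :: cs))%:R = (size cs)%:R + 1 :> R by rewrite natr1.
by rewrite mulrDl mul1r; lra.
Qed.

(* On a grid of [k ^ 2] disjoint blocks each drop costs a fixed amount, while
   the number of leaders is at most linear in [k]. *)
Lemma arm_prob_not_to1 q N : 0 <= q -> q < 1 / 2 ->
  ~ (forall n, (N <= n)%N -> 1 - arm_prob q N n <= (8^-1) ^+ 4).
Proof.
move=> q0 q1 H; set delta := (1 / 2 - q) ^+ size (box_seq N) / 2.
have delta0 : 0 < delta by rewrite /delta divr_gt0// exprn_gt0// subr_gt0.
(* With [k = m + 1], there are at most [k (8 (2 N + 1) + 4)] leaders while the blocks cost at least
   [k ^ 2 delta]; this [m] makes the second number larger. *)
have [m mP] : exists m : nat, (8 * (2 * N + 1) + 4)%:R < m%:R * delta.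
  exists (Num.bound ((8 * (2 * N + 1) + 4)%:R / delta)).
  by rewrite -ltr_pdivrMr//; apply: archi_boundP; rewrite divr_ge0// ltW.
pose k := m.+1; pose M := (k * (2 * N + 1))%N.
pose cs : seq vertex := [seq ((i * (2 * N + 1))%:Z, (j * (2 * N + 1))%:Z) |
   i <- iota 0 k, j <- iota 0 k].
have ucs : uniq cs.
  apply: allpairs_uniq; rewrite ?iota_uniq// => -[i j] [i' j'] _ _ /= [] /eqP + /eqP.
  by rewrite !eqn_pmul2r ?addn1// => /eqP -> /eqP ->.
have scs : size cs = (k * k)%N by rewrite size_allpairs size_iota.
have csP c : c \in cs -> exists i j, [/\ (i < k)%N, (j < k)%N &
    c = ((i * (2 * N + 1))%:Z, (j * (2 * N + 1))%:Z)].
  by move=> /allpairsP[ij [+ + ->]]; rewrite !mem_iota => ? ?; exists ij.1, ij.2.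
have NM : (N <= M.*2)%N by rewrite /M /k; nia.
have := @block_steps q N M cs all_closed q0 (ltW q1) ucs (H _ NM).
rewrite -/delta scs => /(_ _ _) h.
have {h} h : (k * k)%:R * delta <= expect (fun=> q) (box_seq (4 * M)) (leaders M) all_closed -
    expect (block_weight q N cs) (box_seq (4 * M)) (leaders M) all_closed.
  apply: h.
    move=> c /csP[i [j [ik jk ->]]]; rewrite /norm /= /M.
    have : (i.+1 * (2 * N + 1) <= k * (2 * N + 1))%N by rewrite leq_mul2r ik orbT.
    have : (j.+1 * (2 * N + 1) <= k * (2 * N + 1))%N by rewrite leq_mul2r jk orbT.
    by rewrite !mulSn; lia.
  move=> c c' u /csP[i [j [_ _ ->]]] /csP[i' [j' [_ _ ->]]].
  rewrite !mem_block /norm /vsub /= => h1 h2.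
  have sep (a b : nat) (z : int) : (`|(z - (a * (2 * N + 1))%:Z)%R| <= N)%N ->
      (`|(z - (b * (2 * N + 1))%:Z)%R| <= N)%N -> a = b.
    move=> ha hb; have [ab|ab|//] := ltngtP a b.
      have : (a.+1 * (2 * N + 1) <= b * (2 * N + 1))%N by rewrite leq_mul2r ab orbT.
      by rewrite mulSn; lia.
    have : (b.+1 * (2 * N + 1) <= a * (2 * N + 1))%N by rewrite leq_mul2r ab orbT.
    by rewrite mulSn; lia.
  move: h1 h2; rewrite !geq_max => /andP[h1 h2] /andP[h3 h4].
  by rewrite (sep _ _ _ h1 h3) (sep _ _ _ h2 h4).
have qP : is_prob (fun _ : vertex => q) by move=> u; lra.
have rP : is_prob (block_weight q N cs).
  by move=> u; have := block_weight_bounds N cs u q0 (ltW q1); lra.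
have le1 : expect (fun=> q) (box_seq (4 * M)) (leaders M) all_closed <= (8 * M + 4)%:R.
  apply: le_trans (_ : _ <= (size (boundary_seq M))%:R) _; last first.
    by rewrite ler_nat size_boundary_seq.
  rewrite -[leRHS](expect_cst (fun=> q) (box_seq (4 * M)) _ all_closed).
  by apply: le_expect => // w; exact: leaders_le.
have ge0 : 0 <= expect (block_weight q N cs) (box_seq (4 * M)) (leaders M) all_closed.
  by apply: expect_ge0 => // w; exact: leaders_ge0.
have : (8 * M + 4)%:R <= k%:R * (8 * (2 * N + 1) + 4)%:R :> R.
  by rewrite -natrM ler_nat /M /k; nia.
have : k%:R * (8 * (2 * N + 1) + 4)%:R < k%:R * (k%:R * delta).
  rewrite ltr_pM2l ?ltr0n//; apply: lt_le_trans mP _.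
  by rewrite ler_wpM2r ?ler_nat// ltW.
move: h; rewrite natrM -mulrA; lra.
Qed.

Lemma exit_mean_lt1 (p : R) : 0 <= p -> p < 1 / 2 ->
  exists L (S : set vertex), [/\ S origin, (forall u, S u -> (norm u < L)%N) &
    exit_mean p L S < 1].
Proof.
move=> p0 p1; apply: contrapT => H.
pose q := (p + 1 / 2) / 2.
have pq : p < q by rewrite /q; lra.
have q1 : q < 1 / 2 by rewrite /q; lra.
have Sge1 n S : S origin -> (forall u, S u -> (norm u < n)%N) -> 1 <= exit_mean p n S.
  by move=> S0 Sn; rewrite leNgt; apply/negP => lt1; apply: H; exists n, S.
(* From [(q - p) (1 - a) <= a] and [(q - p) a <= a] one gets [q - p <= 2 a]. *)
pose c0 := (q - p) / 2.
have c00 : 0 < c0 by rewrite /c0; lra.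
have q01 : 0 <= q <= 1 by lra.
have c0P n : (0 < n)%N -> c0 <= arm_prob q 0 n.
  move=> _; have := @arm_prob_ge _ p q n p0 pq.
  move=> /(_ _ (Sge1 n)); have : q <= 1 by lra.
  move=> q1' /(_ q1'); rewrite /c0; set a := arm_prob q 0 n => h.
  have : (q - p) * a <= a.
    rewrite ler_piMl//; last by lra.
    by apply: prob_ge0 => u.
  by lra.
have e0 : 0 < (8^-1 : R) ^+ 4 by rewrite exprn_gt0 ?invr_gt0.
have [N NP] := arm_prob_to1 q01 c00 c0P e0.
have q0 : 0 <= q by lra.
by apply: (arm_prob_not_to1 q0 q1 (N := N)) => n /NP; lra.
Qed.

End Contradiction.

(** * The law of percolation on finitely many sites *)

Section Law.
Context {d : measure_display} {T : measurableType d} {R : realType}.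
Variables (P : probability T R) (X : vertex -> {RV P >-> bool}) (r : R).
Hypothesis Xr : site_percolation r X.

Lemma prob_state v b : P (X v @^-1` [set b]) = (if b then r else 1 - r)%:E.
Proof.
have [Xtrue _] := Xr; case: b; first exact: Xtrue.
have -> : X v @^-1` [set false] = ~` (X v @^-1` [set true]).
  by apply/seteqP; split=> t /=; case: (X v t).
rewrite probability_setC ?Xtrue ?EFinB//.
by rewrite -[X in measurable X]setTI; exact: measurable_funP.
Qed.

Lemma prob_cylinder s D (E : set configuration) w : uniq (s ++ D) ->
  depends_on [set` s ++ D] E ->
  let Z := [set t | (forall v, v \in s -> X v t = w v) /\ E (fun v => X v t)] in
  measurable Z /\
  P Z = ((\prod_(v <- s) (if w v then r else 1 - r)) * prob (fun=> r) D E w)%:E.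
Proof.
elim: D s w => [|v D IH] s w.
  rewrite cats0 => us Es /=.
  have mX v b : measurable (X v @^-1` [set b]).
    by rewrite -[X in measurable X]setTI; exact: measurable_funP.
  have [Ew|Ew] := pselect (E w); last first.
    have -> : [set t | (forall v, v \in s -> X v t = w v) /\ E (fun v => X v t)] = set0.
      apply/seteqP; split=> // t [Xw EX]; apply: Ew.
      by rewrite (Es _ (fun v => X v t))// => v /Xw.
    by rewrite /prob /= indic0'// mulr0 measure0.
  have -> : [set t | (forall v, v \in s -> X v t = w v) /\ E (fun v => X v t)] =
      \bigcap_(v in [set` s]) (X v @^-1` [set w v]).
    apply/seteqP; split=> [t [Xw _] v /Xw //|t Xw]; split=> [v|]; first exact: Xw.
    by rewrite (Es _ w)// => v; exact: Xw.
  split; first by apply: fin_bigcap_measurable => // v _.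
  have [_ indX] := Xr; rewrite (indX s (fun v => [set w v]))//.
  rewrite /prob /= indic1// mulr1 -prodEFin; apply: eq_bigr => v _.
  exact: prob_state.
move=> usD Es Z.
have perm : perm_eq (s ++ v :: D) ((v :: s) ++ D) by rewrite -cat1s perm_catCA.
have us' : uniq ((v :: s) ++ D) by rewrite -(perm_uniq perm).
have Es' : depends_on [set` (v :: s) ++ D] E.
  by apply: depends_onS Es => u; rewrite /= (perm_mem perm).
have vs : v \notin s by move: us' => /=; rewrite mem_cat negb_or => /andP[/andP[]].
have [m1 P1] := IH (v :: s) (upd w v true) us' Es'.
have [m0 P0] := IH (v :: s) (upd w v false) us' Es'.
pose Zb b := [set t | (forall u, u \in v :: s -> X u t = upd w v b u) /\
  E (fun v => X v t)].
have ZE : Z = Zb true `|` Zb false.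
  apply/seteqP; split=> t.
    move=> [Xw EX]; suff : Zb (X v t) t by case: (X v t); [left|right].
    split=> // u; rewrite in_cons /upd; case: eqP => [-> //|_] /=; exact: Xw.
  have H b : Zb b t -> Z t.
    move=> [Xw EX]; split=> // u us; rewrite Xw ?in_cons ?us ?orbT// /upd.
    by case: eqP us => // ->; rewrite (negbTE vs).
  by move=> [/H|/H].
have Z0 : [disjoint Zb true & Zb false].
  apply/disj_setPLR => t [Xt _] [Xf _].
  by have := Xt v (mem_head _ _); rewrite (Xf v (mem_head _ _)) /upd eqxx.
split; first by rewrite ZE; exact: measurableU.
rewrite ZE measureU//; last by apply/disj_set2P.
rewrite [X in X + _]P1 [X in _ + X]P0 -EFinD !big_cons /= /upd eqxx.
have prodE b : \prod_(j <- s) (if (if j == v then b else w j) then r else 1 - r) =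
    \prod_(j <- s) (if w j then r else 1 - r) :> R.
  rewrite big_seq [RHS]big_seq; apply: eq_bigr => j js.
  by case: eqP => // jv; rewrite jv (negbTE vs) in js.
rewrite !prodE /prob /=; congr EFin; rewrite /upd; ring.
Qed.

Lemma prob_law D (E : set configuration) : uniq D -> depends_on [set` D] E ->
  P [set t | E (fun v => X v t)] = (prob (fun=> r) D E all_closed)%:E.
Proof.
move=> uD ED; have [_] := @prob_cylinder [::] D E all_closed uD ED.
rewrite big_nil mul1r => <-; congr (P _).
by apply/seteqP; split=> t // -[].
Qed.

End Law.

(** * Exponential decay and the two bounds *)

Lemma cluster_boundaryE (w : configuration) n :
  (open_cluster w origin `&` box_boundary n !=set0) <-> arm origin 0 n w.
Proof.
rewrite box_boundaryE /open_cluster site_clusterE; split.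
  move=> [y [oy yn]].
  (* The open path may leave the box before reaching [y], so it is cut at its first visit to the
     sphere. *)
  have oy' : conn_in setT w origin y by apply: conn_sub oy.
  have [||z [zn oz]] := @conn_in_cut _ _ origin n _ _ oy'.
  - by rewrite vsub0.
  - by rewrite vsub0 yn.
  exists origin, z; split; [by rewrite box0E|exact: zn|].
  by apply: conn_in_mono oz => // u [].
move=> /arm0P[y yn oy]; exists y; split=> //.
by apply: conn_sym; apply: conn_sub oy => u [].
Qed.

(** Iterating in steps of length [L] gives the power [n %/ L] of a number below 1; the constant
    [rho^-1] absorbs the rounding of [n / L]. *)
Lemma arm_prob_exp_decay (R : realType) (p : R) : 0 <= p -> p < 1 / 2 ->
  exists C1 C2 : R, [/\ 0 < C1, 0 < C2 &
    forall n, arm_prob p 0 n <= C1 * expR (- C2 * n%:R)].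
Proof.
move=> p0 p1; have [L [S [S0 SL lt1]]] := exit_mean_lt1 p0 p1.
have p01 : 0 <= p <= 1 by lra.
have pP : is_prob (fun _ : vertex => p) by move=> v.
have L0 : (0 < L)%N by apply: leq_ltn_trans (SL _ S0).
(* The maximum keeps [rho] positive, as its logarithm requires, even if [exit_mean] vanishes. *)
pose rho := Num.max (exit_mean p L S) (1 / 2).
have rho0 : 0 < rho by rewrite lt_max orbC; apply/orP; left; lra.
have rho1 : rho < 1 by rewrite gt_max lt1; lra.
have decay m k : arm_prob p 0 (m + k * L) <= rho ^+ k.
  elim: k => [|k IH]; first by rewrite mul0n addn0 expr0; exact: prob_le1.
  have -> : (m + k.+1 * L = (m + k * L) + L)%N by rewrite mulSn addnCA addnC.
  apply: le_trans (arm_prob_submult _ p01 S0 SL) _; rewrite exprS.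
  apply: ler_pM => //.
  - by apply: expect_ge0 => // w; apply: sumr_ge0 => y _; apply: mulr_ge0 => //; exact: indic_ge0.
  - exact: prob_ge0.
  - by rewrite le_max lexx.
exists rho^-1, (- ln rho / L%:R); split.
- by rewrite invr_gt0.
- by rewrite divr_gt0 ?ltr0n// oppr_gt0 ln_lt0// rho0.
move=> n; rewrite {1}(divn_eq n L) addnC.
apply: le_trans (decay _ _) _.
rewrite -ler_pdivrMl ?invr_gt0// invrK -exprS.
rewrite -[X in X ^+ _](@lnK _ rho)// -expRM_natl ler_expR.
have nL : n%:R <= (n %/ L).+1%:R * L%:R :> R.
  by rewrite -natrM ler_nat ltnW// ltn_ceil.
have L0' : 0 < L%:R :> R by rewrite ltr0n.
have -> : - (- ln rho / L%:R) * n%:R = (n%:R / L%:R) * ln rho by ring.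
apply: ler_wnM2r; last by rewrite ler_pdivrMr.
by apply/ltW/ln_lt0; rewrite rho0.
Qed.

Theorem corollary2 (R : realType) (p : R) (p_ge0 : 0 <= p) (p_lt : p < 1 / 2) :
  exists C1 C2 : R, [/\ 0 < C1, 0 < C2 &
    forall n : nat, (1 <= n)%N ->
      (forall (d : measure_display) (T : measurableType d)
          (P : probability T R) (X : vertex -> {RV P >-> bool}),
        site_percolation p X ->
        (P [set w | open_cluster (fun v => X v w) origin
                      `&` box_boundary n !=set0]
           <= (C1 * expR (- C2 * n%:R))%:E)%E)
      /\
      (forall (d : measure_display) (T : measurableType d)
          (P : probability T R) (X : vertex -> {RV P >-> bool}),
        site_percolation (1 - p) X ->
        (P [set w | closed_cluster (fun v => X v w) origin
                      `&` box_boundary n !=set0]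
           <= (C1 * expR (- C2 * n%:R))%:E)%E)].
Proof.
have [C1 [C2 [C10 C20 decay]]] := arm_prob_exp_decay p_ge0 p_lt.
exists C1, C2; split=> // n _.
have armD : depends_on [set` box_seq n] (arm origin 0 n).
  by apply: depends_onS (@connects_dep _ _ _) => u; rewrite box0E /= mem_box_seq.
split=> d T P X Xp.
  have -> : [set w | open_cluster (fun v => X v w) origin `&` box_boundary n !=set0] =
      [set w | arm origin 0 n (fun v => X v w)].
    by apply/seteqP; split=> w /cluster_boundaryE.
  by rewrite (prob_law Xp (box_seq_uniq n) armD) lee_fin; exact: decay.
have -> : [set w | closed_cluster (fun v => X v w) origin `&` box_boundary n !=set0] =
    [set w | arm origin 0 n (dual_config (fun v => X v w))].
  apply/seteqP; split=> w; last by case/cluster_boundaryE => y; exists y.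
  by move=> [y yn]; apply/cluster_boundaryE; exists y.
have armD' : depends_on [set` box_seq n] (fun w => arm origin 0 n (dual_config w)).
  by move=> w w' ww'; apply: armD => u /ww'; rewrite /dual_config => ->.
rewrite (prob_law Xp (box_seq_uniq n) armD') lee_fin.
(* Closed sites have density [1 - (1 - p) = p], so the closed arm has the law of an open arm at
   density [p]. *)
apply: le_trans (decay n); rewrite /prob expect_negb.
rewrite (_ : (fun=> _) = fun=> p); last by apply/funext => v; ring.
rewrite -(arm_prob_translate p (c := origin) 0 (dual_config all_closed) (box_seq_uniq n)).
  rewrite le_eqVlt; apply/orP; left; apply/eqP; apply: eq_expect => w.
  rewrite !indicE; congr (_ %:R); congr nat_of_bool.
  have NN : dual_config (fun v => ~~ w v) = w.
    by apply/funext => u; rewrite /dual_config negbK.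
  by apply/idP/idP; rewrite !in_setE /= NN.
by move=> u; rewrite box0E mem_box_seq.
Qed.
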